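(* Let $p,q,t$ be integers with $2\le p\le q$ and $t\ge 2$, and let $n>q(q+1)(t-1)+3(p-2)$. Then $$Sat\big(n,K_{p}\cup (t-1)K_q\big)=\big\{K_{p-2}\vee \big((t-1)K_{q+1}\cup I_{n-t+3-p-q(t-1)}\big)\big\},$$ i.e., up to isomorphism, $K_{p-2}\vee ((t-1)K_{q+1}\cup I_{n-t+3-p-q(t-1)})$ is the unique $K_p\cup(t-1)K_q$-saturated graph on $n$ vertices with the minimum possible number of edges.
   Context: All graphs are finite and simple. For a fixed graph $H$, a graph $G$ is $H$-saturated if $G$ contains no subgraph isomorphic to $H$, but for every pair of nonadjacent vertices $x,y$ of $G$, the graph $G+xy$ contains a subgraph isomorphic to $H$. The saturation number $sat(n,H)$ is the minimum number of edges of an $H$-saturated graph on $n$ vertices, and $Sat(n,H)$ is the family of $H$-saturated graphs on $n$ vertices with exactly $sat(n,H)$ edges. $K_m$ denotes the complete graph on $m$ vertices ($K_0$ is the empty graph), $I_m$ the edgeless graph on $m$ vertices, $G\cup H$ the disjoint union, $tH$ the disjoint union of $t$ copies of $H$, and $G\vee H$ the join (disjoint union plus all edges between $V(G)$ and $V(H)$). *)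

(* Defs.v *)
From mathcomp Require Import all_boot.

Set Implicit Arguments.
Unset Strict Implicit.
Unset Printing Implicit Defensive.

Record sgraph := SGraph {
  vertex :> finType;
  adj : rel vertex;
  adj_sym : symmetric adj;
  adj_irrefl : irreflexive adj }.

Definition edges (G : sgraph) : {set {set G}} :=
  [set e : {set G} | [exists x : G, exists y : G,
                        adj x y && (e == [set x; y])]].

Definition isomorphic (G H : sgraph) : Prop :=
  exists2 f : G -> H, bijective f & {mono f : x y / adj x y}.

(* Not necessarily induced: an injective f preserving adjacency is an
   isomorphism from H onto the subgraph of G with vertex set f(V(H)) and
   edge set f(E(H)). *)
Definition contains_copy (G H : sgraph) : Prop :=
  exists2 f : H -> G, injective f & {homo f : x y / adj x y}.

(* The conjunct x != y keeps the graph loopless, so that the construction is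
   total; for x = y it returns G. *)
Definition add_edge_rel (G : sgraph) (x y : G) : rel G := fun u v =>
  adj u v
  || (x != y) && ((u == x) && (v == y) || (u == y) && (v == x)).

Lemma add_edge_sym (G : sgraph) (x y : G) : symmetric (add_edge_rel x y).
Proof.
by move=> u v; rewrite /add_edge_rel adj_sym orbC [in RHS]orbC;
   congr (_ && _ || _); rewrite orbC; congr (_ || _); rewrite andbC.
Qed.

Lemma add_edge_irrefl (G : sgraph) (x y : G) :
  irreflexive (add_edge_rel x y).
Proof.
move=> u; rewrite /add_edge_rel adj_irrefl /=; apply/negbTE.
by apply/andP => -[/negP nxy] /orP[] /andP[/eqP ux /eqP uy];
  apply: nxy; rewrite -ux -uy.
Qed.

Definition add_edge (G : sgraph) (x y : G) : sgraph :=
  SGraph (add_edge_sym x y) (add_edge_irrefl x y).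

Definition saturated (H G : sgraph) : Prop :=
  ~ contains_copy G H /\
  forall x y : G, x != y -> ~~ adj x y -> contains_copy (add_edge x y) H.

(* [is_sat n H m] reads "sat(n,H) = m". It is a relation because the minimum
   is undefined when there is no H-saturated graph on n vertices. *)
Definition is_sat (n : nat) (H : sgraph) (m : nat) : Prop :=
  (exists G : sgraph, [/\ #|G| = n, saturated H G & #|edges G| = m]) /\
  (forall G : sgraph, #|G| = n -> saturated H G -> m <= #|edges G|).

Definition Sat (n : nat) (H G : sgraph) : Prop :=
  [/\ #|G| = n, saturated H G & is_sat n H #|edges G|].

Definition complete_rel (m : nat) : rel 'I_m := fun x y => x != y.

Lemma complete_sym (m : nat) : symmetric (@complete_rel m).
Proof. by move=> x y; rewrite /complete_rel eq_sym. Qed.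

Lemma complete_irrefl (m : nat) : irreflexive (@complete_rel m).
Proof. by move=> x; rewrite /complete_rel eqxx. Qed.

Definition complete (m : nat) : sgraph :=
  SGraph (@complete_sym m) (@complete_irrefl m).

Definition edgeless_rel (m : nat) : rel 'I_m := fun _ _ => false.

Lemma edgeless_sym (m : nat) : symmetric (@edgeless_rel m).
Proof. by []. Qed.

Lemma edgeless_irrefl (m : nat) : irreflexive (@edgeless_rel m).
Proof. by []. Qed.

Definition edgeless (m : nat) : sgraph :=
  SGraph (@edgeless_sym m) (@edgeless_irrefl m).

(* [cross] is the adjacency between the two sides. *)
Definition sum_rel (G H : sgraph) (cross : bool) : rel (G + H)%type := fun u v =>
  match u, v with
  | inl x, inl y => adj x y
  | inr x, inr y => adj x y
  | _, _ => cross
  end.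

Lemma sum_sym (G H : sgraph) (cross : bool) : symmetric (@sum_rel G H cross).
Proof. by case=> x [] y //=; apply: adj_sym. Qed.

Lemma sum_irrefl (G H : sgraph) (cross : bool) :
  irreflexive (@sum_rel G H cross).
Proof. by case=> x /=; apply: adj_irrefl. Qed.

Definition disjoint_union (G H : sgraph) : sgraph :=
  SGraph (@sum_sym G H false) (@sum_irrefl G H false).

Definition join (G H : sgraph) : sgraph :=
  SGraph (@sum_sym G H true) (@sum_irrefl G H true).

Definition copies_rel (t : nat) (G : sgraph) : rel ('I_t * G)%type := fun u v =>
  (u.1 == v.1) && adj u.2 v.2.

Lemma copies_sym (t : nat) (G : sgraph) : symmetric (@copies_rel t G).
Proof. by move=> u v; rewrite /copies_rel eq_sym adj_sym. Qed.

Lemma copies_irrefl (t : nat) (G : sgraph) : irreflexive (@copies_rel t G).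
Proof. by move=> u; rewrite /copies_rel adj_irrefl andbF. Qed.

Definition copies (t : nat) (G : sgraph) : sgraph :=
  SGraph (@copies_sym t G) (@copies_irrefl t G).

(* Main.v *)
(** Write a = p - 2 and s = t - 1. In a saturated graph G two nonadjacent vertices
have a common clique of a neighbours. If the minimum degree d exceeds a, counting the
edges at the closed neighbourhood of a vertex of degree d already gives too many edges.
If d = a, the neighbourhood U of a vertex of degree a is a clique joined to everything,
and G' = G - U satisfies: (1) every packing of s disjoint q-cliques leaves an
independent set; (2) every vertex is missed by such a packing. It remains to show that
G' has at least s(q+1)q/2 edges, with equality only for s components K_(q+1).

Nonisolated vertices of G' have degree at least q. After removal of the components
K_(q+1) the inequality is strict. For q = 2 saturation makes adjacency transitive, by
Gallai's argument, so all remaining degrees are at least 3. For q > 2 the closed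
neighbourhood N of a vertex of degree q is a clique. If packings can use at most one
vertex z of N outside N, then N minus z can be removed and s decreases. Otherwise a
discharging argument relative to a single packing, in which vertices of large degree pay
for the covered vertices of degree q, shows that the average degree is large enough. *)

Require Import Defs.
From mathcomp Require Import all_boot zify.

Set Implicit Arguments.
Unset Strict Implicit.
Unset Printing Implicit Defensive.

(** * Packings of disjoint cliques *)

Section Packings.

Variables (T : finType) (e : rel T).
Hypotheses (e_sym : symmetric e) (e_irr : irreflexive e).

Implicit Types (A B N Q : {set T}) (P : {set {set T}}).

Definition clique Q := {in Q &, forall x y, x != y -> e x y}.

Definition nbh A v := [set u in A | e v u].

Definition disjoint_family P :=
  forall Q Q' x, Q \in P -> Q' \in P -> x \in Q -> x \in Q' -> Q = Q'.

Record packing q A s P : Prop := Packing {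
  pk_card : #|P| = s;
  pk_size : forall Q, Q \in P -> #|Q| = q;
  pk_sub : forall Q, Q \in P -> Q \subset A;
  pk_clique : forall Q, Q \in P -> clique Q;
  pk_disj : disjoint_family P }.

Definition robust q A s :=
  (forall P u v, packing q A s P -> u \in A -> v \in A ->
     u \notin cover P -> v \notin cover P -> ~~ e u v) /\
  (forall v, exists2 P, packing q A s P & v \notin cover P).

Lemma in_nbh A u v : (u \in nbh A v) = (u \in A) && e v u.
Proof. by rewrite inE. Qed.

Lemma neq_of_adj x y : e x y -> x != y.
Proof. by apply: contraTneq => ->; rewrite e_irr. Qed.

Lemma cliqueS Q Q' : Q' \subset Q -> clique Q -> clique Q'.
Proof. by move=> /subsetP sQ cQ x y /sQ xQ /sQ; apply: cQ. Qed.

Lemma cliqueU1 Q v :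
  clique Q -> (forall x, x \in Q -> x != v -> e v x) -> clique (v |: Q).
Proof.
move=> cQ vQ x y /setU1P[->|xQ] /setU1P[->|yQ]; rewrite ?eqxx //.
- by rewrite eq_sym; apply: vQ.
- by rewrite e_sym; apply: vQ.
- exact: cQ.
Qed.

Lemma coverP P x : reflect (exists2 Q, Q \in P & x \in Q) (x \in cover P).
Proof. exact: bigcupP. Qed.

Lemma disjoint_family_trivI P : disjoint_family P -> trivIset P.
Proof.
move=> dP; apply/trivIsetP => Q Q' QP Q'P nQQ'.
apply/pred0P => x /=; apply/negbTE/andP => -[xQ xQ'].
by move/eqP: nQQ'; apply; apply: dP xQ xQ'.
Qed.

Lemma clique_sub_nbh A Q x :
  Q \subset A -> clique Q -> x \in Q -> Q :\ x \subset nbh A x.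
Proof.
move=> sQ cQ xQ; apply/subsetP => y /setD1P[nyx yQ].
by rewrite in_nbh (subsetP sQ) // cQ // eq_sym.
Qed.

Section Fixed.

Variable q : nat.
Hypothesis q_gt0 : 0 < q.

Lemma card_cover A s P : packing q A s P -> #|cover P| = s * q.
Proof.
move=> pP; have /eqP <- := disjoint_family_trivI (pk_disj pP).
rewrite (eq_bigr (fun=> q)) => [|Q]; last exact: (pk_size pP).
by rewrite sum_nat_const (pk_card pP).
Qed.

Lemma sum_cover A s P (f : T -> nat) : packing q A s P ->
  \sum_(v in cover P) f v = \sum_(Q in P) \sum_(v in Q) f v.
Proof. by move=> pP; apply: big_trivIset; apply: disjoint_family_trivI (pk_disj pP). Qed.

Lemma cover_sub A s P : packing q A s P -> cover P \subset A.
Proof. by move=> pP; apply/bigcupsP => Q; apply: (pk_sub pP). Qed.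

Lemma packing_rem A A' s P Q : packing q A s.+1 P -> Q \in P ->
    {in P, forall Q', Q' != Q -> Q' \subset A'} ->
  packing q A' s (P :\ Q).
Proof.
move=> pP QP sub; split=> [|R /setD1P[nR RP]|R /setD1P[nR RP]|R /setD1P[nR RP]|].
- by have := cardsD1 Q P; rewrite QP (pk_card pP) => -[].
- exact: (pk_size pP).
- exact: sub.
- exact: (pk_clique pP).
- by move=> R R' x /setD1P[_ RP] /setD1P[_ R'P]; apply: (pk_disj pP).
Qed.

Lemma packing_add A A' s P Q : packing q A' s P -> A' \subset A ->
    Q \subset A -> clique Q -> #|Q| = q ->
    {in Q, forall x, x \notin cover P} ->
  packing q A s.+1 (Q |: P).
Proof.
move=> pP sA sQ cQ qQ dQ.
have QnP : Q \notin P.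
  apply/negP => QP; have /card_gt0P[x xQ] : 0 < #|Q| by rewrite qQ.
  by move/coverP: (dQ x xQ); apply; exists Q.
split.
- by rewrite cardsU1 QnP (pk_card pP).
- by move=> R /setU1P[->//|]; apply: (pk_size pP).
- by move=> R /setU1P[->//|/(pk_sub pP) sR]; apply: subset_trans sR sA.
- by move=> R /setU1P[->//|]; apply: (pk_clique pP).
- move=> R R' x /setU1P[->|RP] /setU1P[->|R'P] // xR xR'.
  + by case/coverP: (dQ x xR); exists R'.
  + by case/coverP: (dQ x xR'); exists R.
  + exact: (pk_disj pP) xR xR'.
Qed.

Lemma cover_rem A s P Q : packing q A s P -> Q \in P ->
  cover (P :\ Q) = cover P :\: Q.
Proof.
move=> pP QP; apply/setP => x; rewrite inE; apply/coverP/andP.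
  case=> R /setD1P[nRQ RP] xR; split; last by apply/coverP; exists R.
  by apply: contra nRQ => xQ; apply/eqP; apply: (pk_disj pP) xR xQ.
case=> nxQ /coverP[R RP xR]; exists R => //; apply/setD1P; split=> //.
by apply: contraNneq nxQ => <-.
Qed.

Lemma coverU1 P Q : cover (Q |: P) = Q :|: cover P.
Proof.
apply/setP => x; rewrite inE; apply/coverP/orP.
  by case=> R /setU1P[->|RP] xR; [left | right; apply/coverP; exists R].
case=> [xQ|/coverP[R RP xR]]; first by exists Q; rewrite // setU11.
by exists R; rewrite // setU1r.
Qed.

Lemma packing_replace A s P Q Q' : packing q A s P -> Q \in P ->
    Q' \subset A -> clique Q' -> #|Q'| = q ->
    {in Q', forall x, x \in cover P -> x \in Q} ->
  packing q A s (Q' |: (P :\ Q)).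
Proof.
move=> pP QP sQ' cQ' qQ' dQ'.
have s_gt0 : 0 < s by rewrite -(pk_card pP); apply/card_gt0P; exists Q.
rewrite -(prednK s_gt0) in pP *.
have pP' : packing q A s.-1 (P :\ Q).
  by apply: (packing_rem pP QP) => R RP _; apply: (pk_sub pP).
apply: (packing_add pP' _ sQ' cQ' qQ') => // x xQ'.
rewrite (cover_rem pP QP) inE negb_and negbK.
by case: (boolP (x \in cover P)) => [/dQ' ->//|_]; rewrite orbT.
Qed.

Lemma packing_swap A s P Q u v : packing q A s P -> Q \in P -> u \in Q ->
    v \in A -> v \notin cover P -> {in Q, forall x, x != u -> e v x} ->
  exists2 P', packing q A s P' & cover P' = v |: (cover P :\ u).
Proof.
move=> pP QP uQ vA nv vQ.
have nvQ : v \notin Q by apply: contra nv => vQ'; apply/coverP; exists Q.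
exists ((v |: (Q :\ u)) |: (P :\ Q)).
  apply: (packing_replace pP QP).
  - by rewrite subUset sub1set vA (subset_trans (subsetDl _ _)) // (pk_sub pP).
  - apply: cliqueU1; first by apply: cliqueS (subsetDl _ _) (pk_clique pP QP).
    by move=> x /setD1P[nxu xQ] _; apply: vQ.
  - rewrite cardsU1 !inE negb_and nvQ orbT.
    by have := cardsD1 u Q; rewrite uQ (pk_size pP QP) => <-.
  - by move=> x /setU1P[->|/setD1P[]//]; rewrite (negbTE nv).
rewrite coverU1 (cover_rem pP QP); apply/setP => x; rewrite !inE.
case: (boolP (x \in Q)) => xQ /=; last first.
  have -> : x != u by apply: contraNneq xQ => ->.
  by rewrite andbF orbF.
rewrite andbT orbF; congr (_ || _).
by have -> : x \in cover P by [apply/coverP; exists Q]; rewrite andbT.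
Qed.

Lemma covered_of_adj A s P u v : robust q A s -> packing q A s P ->
  u \in A -> v \in A -> e u v -> v \notin cover P -> u \in cover P.
Proof.
case=> h _ pP uA vA euv nv; apply: contraLR euv => nu.
exact: (h _ _ _ pP).
Qed.

(** A packing that misses a neighbour [z] of [y] must cover [y]; the other [q - 1] vertices of the
    clique through [y], together with [z], are [q] neighbours. *)
Lemma deg_ge A s y : robust q A s -> y \in A -> 0 < #|nbh A y| ->
  q <= #|nbh A y|.
Proof.
move=> gA yA /card_gt0P[z]; rewrite in_nbh => /andP[zA eyz].
have [P pP nz] := gA.2 z.
have /coverP[Q QP yQ] := covered_of_adj gA pP yA zA eyz nz.
have nzQ : z \notin Q by apply: contra nz => zQ; apply/coverP; exists Q.
have -> : q = #|z |: Q :\ y|.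
  rewrite cardsU1 !inE negb_and nzQ orbT -(pk_size pP QP).
  by have := cardsD1 y Q; rewrite yQ.
rewrite subset_leq_card // subUset sub1set in_nbh zA eyz.
by rewrite clique_sub_nbh //; [apply: (pk_sub pP)|apply: (pk_clique pP)].
Qed.

End Fixed.
End Packings.

(** * Degree sums and vertices of degree q *)

Section DegreeSums.

Variables (T : finType) (e : rel T).
Hypotheses (e_sym : symmetric e) (e_irr : irreflexive e).

Implicit Types (A B N Q : {set T}) (P : {set {set T}}).

Definition degsum A := \sum_(v in A) #|nbh e A v|.

Lemma card_nbh A v : #|nbh e A v| = \sum_(u in A) e v u.
Proof.
rewrite -sum1_card (eq_bigl (fun u => (u \in A) && e v u)) => [|u].
  by rewrite big_mkcondr; apply: eq_bigr => u _; case: (e v u).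
by rewrite in_nbh.
Qed.

Lemma sum_nbhC A B :
  \sum_(v in A) #|nbh e B v| = \sum_(v in B) #|nbh e A v|.
Proof.
under eq_bigr => v _ do rewrite card_nbh.
rewrite exchange_big; apply: eq_bigr => v _; rewrite card_nbh.
by apply: eq_bigr => u _; rewrite e_sym.
Qed.

Lemma sum_setD A B (f : T -> nat) : B \subset A ->
  \sum_(v in A) f v = \sum_(v in A :\: B) f v + \sum_(v in B) f v.
Proof.
move=> sBA; rewrite (big_setID B) /= addnC; congr (_ + _).
by rewrite (setIidPr sBA).
Qed.

Lemma card_nbhD A B v : B \subset A ->
  #|nbh e A v| = #|nbh e (A :\: B) v| + #|nbh e B v|.
Proof. by move=> sBA; rewrite !card_nbh; apply: sum_setD. Qed.

(** Stated additively to avoid truncated subtraction. Twice the sum on the right counts the edges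
    inside [B] too often, by exactly [degsum B]. *)
Lemma degsumD A B : B \subset A ->
  degsum A + degsum B = degsum (A :\: B) + 2 * \sum_(v in B) #|nbh e A v|.
Proof.
move=> sBA; rewrite {1}/degsum (sum_setD _ sBA).
have -> : \sum_(v in A :\: B) #|nbh e A v| =
          degsum (A :\: B) + \sum_(v in B) #|nbh e (A :\: B) v|.
  under eq_bigr => v _ do rewrite (card_nbhD _ sBA).
  by rewrite big_split /=; congr (_ + _); rewrite sum_nbhC.
have -> : \sum_(v in B) #|nbh e A v| =
          \sum_(v in B) #|nbh e (A :\: B) v| + degsum B.
  by under eq_bigr => v _ do rewrite (card_nbhD _ sBA); rewrite big_split.
lia.
Qed.

Lemma nbh_clique B v : clique e B -> v \in B -> nbh e B v = B :\ v.
Proof.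
move=> cB vB; apply/setP => u; rewrite in_nbh in_setD1 andbC.
apply: andb_id2r => uB; apply/idP/idP => [|/cB h].
  by rewrite eq_sym; apply: neq_of_adj.
by rewrite e_sym h.
Qed.

Lemma degsum_clique B : clique e B -> degsum B = #|B| * #|B|.-1.
Proof.
move=> cB; rewrite /degsum (eq_bigr (fun=> #|B|.-1)) ?sum_nat_const // => v vB.
by rewrite nbh_clique //; have := cardsD1 v B; rewrite vB => ->.
Qed.

Lemma degsum0 A : {in A &, forall u v, ~~ e u v} -> degsum A = 0.
Proof.
move=> h; apply: big1 => v vA; apply/eqP; rewrite cards_eq0; apply/eqP/setP => u.
by rewrite in_nbh inE; apply/negbTE/andP => -[uA]; apply/negP/h.
Qed.

Lemma card_succP Q N : Q \subset N -> #|N| = #|Q|.+1 ->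
  exists2 v, v \notin Q & N = v |: Q.
Proof.
move=> sQN cN; have : #|N :\: Q| == 1.
  by rewrite cardsDS // cN subSnn.
case/cards1P=> v Nv; exists v.
  by have := set11 v; rewrite -Nv inE => /andP[].
by rewrite -{1}(setID N Q) (setIidPr sQN) Nv setUC.
Qed.

Definition universal (U : {set T}) := forall u v, u \in U -> v != u -> e u v.

Lemma universal_clique U : universal U -> clique e U.
Proof. by move=> uU x y xU _ nxy; apply: uU; rewrite // eq_sym. Qed.

(** This is [degsumD] for the clique [U], whose vertices have degree [#|T| - 1]. It reduces the edge
    count to the graph outside [U]. *)
Lemma degsum_universal U : universal U ->
  degsum setT + #|U| * #|U|.+1 = 2 * #|U| * #|T| + degsum (~: U).
Proof.
move=> uU; have := degsumD (subsetT U); rewrite setTD.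
rewrite (degsum_clique (universal_clique uU)).
have -> : \sum_(v in U) #|nbh e setT v| = #|U| * #|T|.-1.
  rewrite -sum_nat_const; apply: eq_bigr => v vU.
  have -> : nbh e setT v = setT :\ v.
    apply/setP => u; rewrite in_nbh in_setD1 inE andbT.
    by apply/idP/idP => [/(neq_of_adj e_irr)|/uU->//]; rewrite eq_sym.
  by have := cardsD1 v setT; rewrite cardsT inE => ->.
have [->|U_gt0] := posnP #|U|; first by rewrite !muln0; lia.
have : #|U| <= #|T| by apply: max_card.
by case: #|T| => [|m]; case: #|U| U_gt0 => // k _ _; nia.
Qed.

(** * Closed neighbourhoods of vertices of degree [q], for [q > 2] *)

Section Heavy.

Variable q : nat.
Hypothesis q_gt2 : 2 < q.
Let q_gt0 : 0 < q := ltnW (ltnW q_gt2).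

Definition low A := [set y in A | #|nbh e A y| == q].

Definition cnbh A y := y |: nbh e A y.

Lemma cnbh_sub A y : y \in A -> cnbh A y \subset A.
Proof.
move=> yA; rewrite subUset sub1set yA; apply/subsetP => u.
by rewrite in_nbh => /andP[].
Qed.

Lemma card_cnbh A y : y \in low A -> #|cnbh A y| = q.+1.
Proof.
by rewrite inE => /andP[_ /eqP dy]; rewrite cardsU1 in_nbh e_irr andbF dy.
Qed.

Lemma low_sub A y : y \in low A -> y \in A.
Proof. by rewrite inE => /andP[]. Qed.

(** Since [q > 2], two neighbours [a], [b] of [y] leave a third one [z]. A packing missing [z]
    covers [y] by a [q]-clique inside [N[y]] minus [z], hence equal to it and containing both [a]
    and [b]. *)
Lemma cnbh_clique A s y : robust e q A s -> y \in low A -> clique e (cnbh A y).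
Proof.
move=> gA ly; have yA := low_sub ly; apply: cliqueU1 => //; last first.
  by move=> x; rewrite in_nbh => /andP[].
move=> a b aN bN nab.
have [z zN [nza nzb]] : exists2 z, z \in nbh e A y & z != a /\ z != b.
  have : 0 < #|nbh e A y :\: [set a; b]|.
    have := cardsD (nbh e A y) [set a; b].
    have := subset_leq_card (subsetIr (nbh e A y) [set a; b]).
    by move: ly; rewrite inE cards2 => /andP[_ /eqP]; lia.
  case/card_gt0P=> z; rewrite !inE negb_or => /andP[/andP[nza nzb] zN].
  by exists z; rewrite ?in_nbh.
move: (zN); rewrite in_nbh => /andP[zA eyz].
have [P pP nz] := gA.2 z.
have /coverP[Q QP yQ] := covered_of_adj gA pP yA zA eyz nz.
have nzQ : z \notin Q by apply: contra nz => zQ; apply/coverP; exists Q.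
have sQ := clique_sub_nbh (pk_sub pP QP) (pk_clique pP QP) yQ.
have eQ : Q :\ y = nbh e A y :\ z.
  apply/eqP; rewrite eqEcard; apply/andP; split.
    apply/subsetP => u uQ; rewrite in_setD1 (subsetP sQ) // andbT.
    by apply: contraNneq nzQ => <-; case/setD1P: uQ.
  have := cardsD1 y Q; rewrite yQ (pk_size pP QP).
  have := cardsD1 z (nbh e A y); rewrite zN.
  by move: ly; rewrite inE => /andP[_ /eqP]; clear; lia.
have inQ u : u \in nbh e A y -> z != u -> u \in Q.
  by move=> uN nzu; have : u \in Q :\ y; [rewrite eQ !inE eq_sym nzu -in_nbh | case/setD1P].
by apply: (pk_clique pP QP) => //; apply: inQ.
Qed.

Lemma cnbh_eq A s y y' : robust e q A s -> y \in low A -> y' \in low A ->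
  y' \in cnbh A y -> cnbh A y' = cnbh A y.
Proof.
move=> gA ly ly' y'N; apply/esym/eqP; rewrite eqEcard !card_cnbh // leqnn andbT.
have cN := cnbh_clique gA ly.
rewrite -(setD1K y'N) setUS // clique_sub_nbh //.
exact/cnbh_sub/low_sub.
Qed.

Lemma packing_low A s P Q y : packing e q A s P -> Q \in P ->
  y \in Q -> y \in low A -> exists2 v, v \notin Q & cnbh A y = v |: Q.
Proof.
move=> pP QP yQ ly; apply: card_succP; last by rewrite card_cnbh ?(pk_size pP).
by rewrite -(setD1K yQ) setUS // clique_sub_nbh //;
  [apply: (pk_sub pP) | apply: (pk_clique pP)].
Qed.

Lemma deg_ge_covered A s P Q v (X : {set T}) : packing e q A s P -> Q \in P -> v \in Q ->
    X \subset nbh e A v -> {in X, forall x, x \notin Q} ->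
  q.-1 + #|X| <= #|nbh e A v|.
Proof.
clear q_gt0 q_gt2; move=> pP QP vQ sX dX.
have sQ := clique_sub_nbh (pk_sub pP QP) (pk_clique pP QP) vQ.
have <- : #|Q :\ v| = q.-1.
  by have := cardsD1 v Q; rewrite vQ (pk_size pP QP) => ->.
have : #|X| <= #|nbh e A v :\: (Q :\ v)|.
  apply/subset_leq_card/subsetP => x xX; rewrite in_setD (subsetP sX) // andbT.
  by rewrite in_setD1 negb_and dX // orbT.
by rewrite cardsDS //; have := subset_leq_card sQ; lia.
Qed.

Lemma clique_nbh_mem A N u v : N \subset A -> clique e N -> u \in N -> v \in N ->
  u != v -> u \in nbh e A v.
Proof.
by move=> sN cN uN vN nuv; rewrite in_nbh (subsetP sN) // cN // eq_sym.
Qed.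

Lemma low_pair_covered A s P y : robust e q A s -> packing e q A s P ->
  y \in low A -> 1 < #|low A :&: cnbh A y| ->
  exists y', [/\ y' \in low A, cnbh A y' = cnbh A y & y' \in cover P].
Proof.
move=> gA pP ly /card_gt1P[p0 [p1 [/setIP[l0 n0] /setIP[l1 n1] n01]]].
have e01 : e p0 p1 by apply: (cnbh_clique gA ly).
have [c0|nc0] := boolP (p0 \in cover P).
  by exists p0; rewrite (cnbh_eq gA ly l0).
exists p1; rewrite (cnbh_eq gA ly l1) //; split=> //.
by apply: (covered_of_adj gA pP (low_sub l1) (low_sub l0) _ nc0); rewrite e_sym.
Qed.

(* Only z can be used outside N = N[y] by a packing, so every packing contains a
   clique N minus a vertex whose removal leaves a packing of A minus (N minus z). *)
Lemma robust_reduce A s y z : robust e q A s.+1 ->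
    y \in low A -> 1 < #|low A :&: cnbh A y| -> z \in cnbh A y ->
    {in cnbh A y, forall v, v != z -> #|nbh e A v| < q.-1 + q} ->
  robust e q (A :\: (cnbh A y :\ z)) s.
Proof.
move=> gA ly cy zN hN; set N := cnbh A y; set A1 := A :\: _.
have cN : clique e N := cnbh_clique gA ly.
have sN : N \subset A := cnbh_sub (low_sub ly).
have sBA : N :\ z \subset A := subset_trans (subsetDl _ _) sN.
have qB : #|N :\ z| = q.
  by have := cardsD1 z N; rewrite zN card_cnbh // => -[].
split=> [P u v pP|w].
  have dB : {in N :\ z, forall x, x \notin cover P}.
    move=> x xB; apply/negP => /(subsetP (cover_sub pP)).
    by rewrite in_setD xB.
  have pP' : packing e q A s.+1 ((N :\ z) |: P).
    by apply: (packing_add q_gt0 pP); rewrite ?subsetDl //;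
      apply: cliqueS cN; apply: subsetDl.
  case/setDP=> uA nuB /setDP[vA nvB] nu nv.
  by apply: (gA.1 _ _ _ pP' uA vA); rewrite coverU1 in_setU negb_or ?nuB ?nvB.
wlog nwB : w / w \notin N :\ z => [h|].
  have [wB|] := boolP (w \in N :\ z); last exact: h.
  have [|P pP _] := h z; first by rewrite !inE eqxx.
  exists P => //; apply/negP => /(subsetP (cover_sub pP)).
  by rewrite in_setD wB.
have [P pP nw] := gA.2 w.
have [y' [ly' Ny' /coverP[Q QP y'Q]]] := low_pair_covered gA pP ly cy.
have [v nvQ] := packing_low pP QP y'Q ly'; rewrite Ny' -/N => NvQ.
exists (P :\ Q); last by rewrite (cover_rem pP QP) in_setD (negbTE nw) andbF.
apply: (packing_rem pP QP) => R RP nRQ; apply/subsetP => x xR.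
rewrite in_setD (subsetP (pk_sub pP RP)) // andbT; apply/negP => /setD1P[nxz xN].
have nQ u : u \in R -> u \notin Q.
  by move=> uR; apply: contra nRQ => uQ; apply/eqP/(pk_disj pP RP QP uR uQ).
have xv : x = v.
  by move: xN; rewrite NvQ => /setU1P[//|xQ]; case/negP: (nQ _ xR).
(* If another clique [R] meets [N :\ z], it does so in the one vertex of [N] outside [Q]; that
   vertex has [q - 1] neighbours in [R] and [q] in [Q], too many for [hN]. *)
have : q.-1 + #|Q| <= #|nbh e A x|.
  apply: (deg_ge_covered pP RP xR) => [|u uQ]; last first.
    by apply/negP => uR; case/negP: (nQ _ uR).
  apply/subsetP => u uQ; apply: (clique_nbh_mem sN cN) => //.
    by rewrite NvQ setU1r.
  by rewrite xv; apply: contraNneq nvQ => <-.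
by rewrite (pk_size pP QP) leqNgt hN.
Qed.

(** Suppose [u] and [v] are distinct. A packing missing some [p0] of degree [q] in [N[y]] contains
    the clique [Q], which is [N[y]] minus [p0], and it misses [y2]. Putting [p0] in the place of [v]
    leaves the adjacent vertices [y2] and [v] both uncovered. *)
Lemma low_inter A s y y2 u v : robust e q A s ->
    y \in low A -> 1 < #|low A :&: cnbh A y| ->
    y2 \in low A -> y2 \notin cnbh A y ->
    u \in cnbh A y -> u \in cnbh A y2 -> v \in cnbh A y -> v \in cnbh A y2 ->
  u = v.
Proof.
move=> gA ly /card_gt1P[p0 [p1 [/setIP[l0 n0] /setIP[l1 n1] n01]]] l2 n2.
move=> uN uN2 vN vN2; apply/eqP/negPn/negP => nuv.
have cN := cnbh_clique gA ly; have cN2 := cnbh_clique gA l2.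
have sN := cnbh_sub (low_sub ly).
have N0 := cnbh_eq gA ly l0 n0; have N1 := cnbh_eq gA ly l1 n1.
have [P pP nc0] := gA.2 p0.
have e10 : e p1 p0 by apply: cN => //; rewrite eq_sym.
have /coverP[Q QP p1Q] := covered_of_adj gA pP (low_sub l1) (low_sub l0) e10 nc0.
have [v0 nv0] := packing_low pP QP p1Q l1; rewrite N1 => NvQ.
have v0p0 : p0 = v0.
  move: n0; rewrite NvQ => /setU1P[//|p0Q].
  by case/negP: nc0; apply/coverP; exists Q.
have inQ x : x \in cnbh A y -> x \in cnbh A y2 -> x \in Q.
  move=> xN xN2; move: (xN); rewrite NvQ -v0p0 => /setU1P[x0|//].
  case/negP: n2; rewrite -N0 (cnbh_eq gA l2 l0) ?setU11 //.
  by rewrite -x0.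
have nc2 : y2 \notin cover P.
  apply/negP => /coverP[R RP y2R].
  have [v2 nv2 Nv2] := packing_low pP RP y2R l2.
  have QR : Q = R.
    have [uv2|nuv2] := eqVneq u v2.
      apply: (pk_disj pP QP RP (inQ _ vN vN2)).
      by move: vN2; rewrite Nv2 => /setU1P[vv2|//]; rewrite uv2 vv2 eqxx in nuv.
    apply: (pk_disj pP QP RP (inQ _ uN uN2)).
    by move: uN2; rewrite Nv2 => /setU1P[uv2|//]; rewrite uv2 eqxx in nuv2.
  by case/negP: n2; rewrite NvQ QR setU1r.
have vQ := inQ _ vN vN2.
have [|P' pP' cP'] := packing_swap e_sym q_gt0 pP QP vQ (low_sub l0) nc0.
  move=> x xQ nxv; apply: cN => //; first by rewrite NvQ setU1r.
  by rewrite v0p0; apply: contraNneq nv0 => ->.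
have e2v : e y2 v.
  by apply: cN2; rewrite ?setU11 //; apply: contraNneq n2 => ->.
have vA : v \in A by apply: (subsetP sN).
have : v \notin cover P'.
  rewrite cP' !inE eqxx /= orbF; apply: contraNneq nc0 => <-.
  by apply/coverP; exists Q.
move/(covered_of_adj gA pP' (low_sub l2) vA e2v); rewrite cP' !inE (negbTE nc2).
rewrite andbF orbF => /eqP y20; case/negP: n2.
by rewrite y20 NvQ -v0p0 setU11.
Qed.

End Heavy.
End DegreeSums.

(** * The degree sum of a robust set for q > 2 *)

Section Discharging.

Variables (T : finType) (e : rel T) (q : nat).
Hypotheses (e_sym : symmetric e) (e_irr : irreflexive e) (q_gt2 : 2 < q).
Let q_gt0 : 0 < q := ltnW (ltnW q_gt2).

Implicit Types (A B N Q : {set T}) (P : {set {set T}}).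

Local Notation nbh := (nbh e).
Local Notation low := (low e q).
Local Notation cnbh := (cnbh e).
Local Notation degsum := (degsum e).

(** * Discharging when no closed neighbourhood can be reduced *)

Section Irreducible.

Variables (A : {set T}) (s : nat) (P : {set {set T}}).
Hypotheses (gA : robust e q A s) (pP : packing e q A s P).
Hypothesis irr : forall y z, y \in low A -> 1 < #|low A :&: cnbh A y| ->
  z \in cnbh A y ->
  exists v, [/\ v \in cnbh A y, v != z & q.-1 + q <= #|nbh A v|].

Let high_notin_low v : q.-1 + q <= #|nbh A v| -> v \notin low A.
Proof. by rewrite inE negb_and => h; apply/orP; right; lia. Qed.

(** Two applications of [irr] give two distinct vertices of [N[y]] of degree at least [2q - 1 > q],
    which leaves at most [q - 1] of its [q + 1] vertices. *)
Lemma card_low_lt y : y \in low A -> #|low A :&: cnbh A y| < q.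
Proof.
move=> ly; have [|c_le1] := boolP (1 < #|low A :&: cnbh A y|); last by lia.
move=> cy; have yN : y \in cnbh A y by rewrite setU11.
have [v1 [v1N _ d1]] := irr ly cy yN; have [v2 [v2N n21 d2]] := irr ly cy v1N.
have: #|low A :&: cnbh A y| <= #|cnbh A y :\ v1 :\ v2|.
  apply: subset_leq_card; apply/subsetP => x /setIP[lx xN].
  rewrite !in_setD1 xN andbT; apply/andP; split.
    by apply: contraTneq lx => ->; apply: high_notin_low.
  by apply: contraTneq lx => ->; apply: high_notin_low.
have := cardsD1 v1 (cnbh A y); rewrite v1N (card_cnbh e_irr ly).
by have := cardsD1 v2 (cnbh A y :\ v1); rewrite in_setD1 n21 v2N; lia.
Qed.

(* Each clique Q of the packing charges its vertices of degree q to the vertex v with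
   N = v |: Q; if v is covered it takes at most q - 2 of them, and a remaining one is
   charged to the only vertex of Q of larger degree, the bottom of Q. *)
Definition attached Q v :=
  (v \notin Q) && [exists y in Q :&: low A, cnbh A y == v |: Q].

Let attach v := [set Q in P | attached Q v].
Let bottom v :=
  (v \notin low A) && [exists Q in P, (v \in Q) && (#|Q :&: low A| == q.-1)].

Lemma attachedP Q v :
  reflect (v \notin Q /\ exists y, [/\ y \in Q, y \in low A & cnbh A y = v |: Q])
          (attached Q v).
Proof.
apply: (iffP andP) => -[nvQ h]; split=> //.
  by case/exists_inP: h => y /setIP[yQ ly] /eqP Ny; exists y.
by case: h => y [yQ ly Ny]; apply/exists_inP; exists y; [apply/setIP | apply/eqP].
Qed.

Let attach_nbh v : cover (attach v) \subset nbh A v.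
Proof.
apply/subsetP => x /coverP[Q]; rewrite inE => /andP[QP /attachedP[nvQ]].
case=> y [yQ ly Ny] xQ.
apply: (clique_nbh_mem (cnbh_sub e (low_sub ly))).
- exact: (cnbh_clique e_sym q_gt2 gA ly).
- by rewrite Ny setU1r.
- by rewrite Ny setU11.
- by apply: contraNneq nvQ => <-.
Qed.

Let card_attach v : #|cover (attach v)| = #|attach v| * q.
Proof.
apply: (@card_cover _ e q A); split=> //.
- by move=> Q; rewrite inE => /andP[QP _]; apply: (pk_size pP).
- by move=> Q; rewrite inE => /andP[QP _]; apply: (pk_sub pP).
- by move=> Q; rewrite inE => /andP[QP _]; apply: (pk_clique pP).
- move=> Q Q' x; rewrite !inE => /andP[QP _] /andP[Q'P _].
  exact: (pk_disj pP).
Qed.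

(** The attached cliques are disjoint and lie in the neighbourhood of [v], so each gives [q]
    neighbours while only [q - 1] are charged. The slack, or the positive degree if nothing is
    attached, gives strictness. *)
Lemma uncovered_load v : 0 < #|nbh A v| ->
  #|attach v| * q.-1 < #|nbh A v|.
Proof.
have := subset_leq_card (attach_nbh v); rewrite card_attach.
case: #|attach v| => [|j]; first by rewrite mul0n.
nia.
Qed.

(** An attached [Q] would give [N[v] = v |: Q], leaving no room for the clique through [v], which is
    disjoint from [Q]. *)
Lemma low_covered_unattached v Q : v \in cover P -> v \in low A ->
  Q \in P -> ~~ attached Q v.
Proof.
move=> /coverP[R RP vR] lv QP; apply/negP => /attachedP[nvQ [y [yQ ly Ny]]].
have [u nuR Nv] := packing_low e_irr pP RP vR lv.
have eN : cnbh A v = cnbh A y.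
  by apply: (cnbh_eq e_sym e_irr q_gt2 gA) => //; rewrite Ny setU11.
have : 0 < #|R :\ v|.
  by have := cardsD1 v R; rewrite vR (pk_size pP RP); lia.
case/card_gt0P=> x /setD1P[nxv xR].
have : x \in cnbh A y by rewrite -eN Nv setU1r.
rewrite Ny => /setU1P[xv|xQ]; first by rewrite xv eqxx in nxv.
by case/negP: nvQ; rewrite (pk_disj pP QP RP xQ xR).
Qed.

(** With [j] attached cliques the degree of [v] is at least [q - 1 + jq], because the clique [R]
    through [v] is disjoint from them, and at least [q + 1], because it is not [q]. This suffices
    unless [v] is a bottom, where the bound has to be improved. *)
Lemma covered_load v : v \in cover P -> v \notin low A ->
  q.+1 + #|attach v| * q.-2 + bottom v <= #|nbh A v|.
Proof.
move=> vP nlv; have [R RP vR] := coverP _ _ vP.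
have vA : v \in A := subsetP (cover_sub pP) _ vP.
have dR : {in cover (attach v), forall x, x \notin R}.
  move=> x /coverP[Q]; rewrite inE => /andP[QP /andP[nvQ _]] xQ.
  by apply: contra nvQ => xR; rewrite (pk_disj pP QP RP xQ xR).
have := deg_ge_covered pP RP vR (attach_nbh v) dR; rewrite card_attach => dv.
have q_le : q <= #|nbh A v|.
  apply: (deg_ge gA vA).
  have : q.-1 + #|set0 : {set T}| <= #|nbh A v|.
    by apply: (deg_ge_covered pP RP vR); [apply: sub0set | move=> x; rewrite inE].
  by lia.
have {q_le} q_lt : q < #|nbh A v|.
  by rewrite ltn_neqAle q_le andbT eq_sym; move: nlv; rewrite inE vA.
have [/andP[_ /exists_inP[R' R'P /andP[vR' /eqP lR]]]|_] := boolP (bottom v); last first.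
  by case: #|attach v| dv => [|j]; [lia | nia].
have {R' R'P vR'} lR : #|R :&: low A| = q.-1 by rewrite -(pk_disj pP R'P RP vR' vR).
have : 0 < #|R :&: low A| by rewrite lR; lia.
case/card_gt0P=> y /setIP[yR ly].
have [t ntR Ny] := packing_low e_irr pP RP yR ly.
have RlN : R :&: low A \subset low A :&: cnbh A y.
  by apply/subsetP => x /setIP[xR lx]; rewrite in_setI lx Ny setU1r.
have cy : 1 < #|low A :&: cnbh A y|.
  by have := subset_leq_card RlN; rewrite lR; clear -q_gt2; lia.
have RlE : R :&: low A = R :\ v.
  apply/eqP; rewrite eqEcard; apply/andP; split.
    apply/subsetP => x /setIP[xR lx]; rewrite in_setD1 xR andbT.
    by apply: contraNneq nlv => <-.
  by have := cardsD1 v R; rewrite vR (pk_size pP RP) lR => ->.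
have nlt : t \notin low A.
  apply/negP => lt; have := card_low_lt ly; rewrite ltnNge => /negP; apply.
  have : #|t |: (R :&: low A)| <= #|low A :&: cnbh A y|.
    by rewrite subset_leq_card // subUset RlN sub1set in_setI lt Ny setU11.
  by rewrite cardsU1 in_setI (negbTE ntR) lR add1n prednK.
(* With nothing attached, [irr] applied to [t] yields a vertex of degree at least [2q - 1] in
   [N[y]], which can only be [v]; and [2q - 1 >= q + 2]. *)
have [j0|] := posnP #|attach v|.
  have tN : t \in cnbh A y by rewrite Ny setU11.
  have [v' [v'N nv't dv']] := irr ly cy tN.
  suff vv' : v' = v by move: dv'; rewrite vv' j0; clear -q_gt2; lia.
  apply/eqP/negPn/negP => nv'v; have := high_notin_low dv'.
  have : v' \in R :&: low A.
    rewrite RlE in_setD1 nv'v; move: v'N; rewrite Ny => /setU1P[v't|//].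
    by rewrite v't eqxx in nv't.
  by case/setIP=> _ ->.
(* With something attached, [t] is one more neighbour of [v]: in an attached clique, it would lie
   together with [v] in two closed neighbourhoods, against [low_inter]. *)
have ntat : t \notin cover (attach v).
  apply/negP => /coverP[Q]; rewrite inE => /andP[QP /attachedP[nvQ]].
  case=> y2 [y2Q l2 N2] tQ.
  have tv : t = v.
    apply: (low_inter e_sym e_irr q_gt2 gA ly cy l2).
    - rewrite Ny; apply/negP => /setU1P[y2t|y2R].
        by rewrite -y2t l2 in nlt.
      by case/negP: nvQ; rewrite (pk_disj pP QP RP y2Q y2R).
    - by rewrite Ny setU11.
    - by rewrite N2 setU1r.
    - by rewrite Ny setU1r.
    - by rewrite N2 setU11.
  by rewrite -tv tQ in nvQ.
have tnb : t \in nbh A v.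
  apply: (clique_nbh_mem (cnbh_sub e (low_sub ly))).
  - exact: (cnbh_clique e_sym q_gt2 gA ly).
  - by rewrite Ny setU11.
  - by rewrite Ny setU1r.
  - by apply: contraNneq ntR => ->.
have : q.-1 + #|t |: cover (attach v)| <= #|nbh A v|.
  apply: (deg_ge_covered pP RP vR); first by rewrite subUset sub1set tnb attach_nbh.
  by move=> x /setU1P[->//|]; apply: dR.
by rewrite cardsU1 ntat card_attach; clear -q_gt2; case: #|attach v| => [|j]; nia.
Qed.

(** At most [q - 1] vertices of [Q] have degree [q]. The vertex completing [Q] to [N[y]] takes all
    of them, or [q - 2] when it is covered; if one is then left, exactly one vertex of [Q] is not of
    degree [q], and this bottom takes it. *)
Lemma clique_load Q : Q \in P ->
  #|Q :&: low A| <=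
    \sum_(v in A) attached Q v * (if v \in cover P then q.-2 else q.-1)
    + \sum_(v in Q) bottom v.
Proof.
move=> QP; have [->//|/card_gt0P[y /setIP[yQ ly]]] := posnP #|Q :&: low A|.
have [v nvQ Ny] := packing_low e_irr pP QP yQ ly.
have vA : v \in A.
  by apply: (subsetP (cnbh_sub e (low_sub ly))); rewrite Ny setU11.
rewrite (bigD1 v) //=.
have -> : attached Q v by apply/attachedP; split=> //; exists y.
rewrite mul1n.
have lQ : #|Q :&: low A| < q.
  apply: leq_ltn_trans (card_low_lt ly); apply: subset_leq_card.
  by apply/subsetP => x /setIP[xQ lx]; rewrite in_setI lx Ny setU1r.
case: ifP => _; last by lia.
have [lQ'|lQ'] := ltnP #|Q :&: low A| q.-1; first by lia.
have : 0 < #|Q :\: low A|.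
  by have := cardsID (low A) Q; rewrite (pk_size pP QP); lia.
case/card_gt0P=> u /setDP[uQ nlu].
rewrite [\sum_(v in Q) _](bigD1 u) //=.
have -> : bottom u.
  rewrite /bottom nlu; apply/exists_inP; exists Q; rewrite // uQ /=.
  by apply/eqP; lia.
lia.
Qed.

(** Each of the [s * q] covered vertices should account for [q + 1]. Those of degree [q] lack one
    unit each; [clique_load] distributes these deficits, and the surplus in [covered_load] and
    [uncovered_load] pays for them. Strictness comes from [v0]. *)
Lemma irreducible_degsum v0 : v0 \in A -> v0 \notin cover P ->
  0 < #|nbh A v0| -> s * q * q.+1 < degsum A.
Proof.
move=> v0A nv0 dv0.
pose at_ v := #|attach v|.
have sumC : \sum_(v in cover P) (q.+1 + at_ v * q.-2 + bottom v) <=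
            \sum_(v in cover P) (#|nbh A v| + (v \in low A)).
  apply: leq_sum => v vP; have [lv|nlv] := boolP (v \in low A); last first.
    by rewrite addn0; apply: covered_load.
  have -> : at_ v = 0.
    apply/eqP; rewrite cards_eq0; apply/eqP/setP => Q; rewrite !inE.
    by apply/negbTE/andP => -[QP]; apply/negP/low_covered_unattached.
  have dv : #|nbh A v| = q by move: lv; rewrite inE => /andP[_ /eqP].
  by rewrite /bottom lv dv /=; lia.
have sumU : \sum_(v in A :\: cover P) at_ v * q.-1 <
            \sum_(v in A :\: cover P) #|nbh A v|.
  rewrite (bigD1 v0) /= ?inE ?nv0 // [ltnRHS](bigD1 v0) /= ?inE ?nv0 //.
  rewrite -addSn leq_add ?uncovered_load //; apply: leq_sum => v _.
  have [d0|/uncovered_load/ltnW//] := posnP #|nbh A v|.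
  have := subset_leq_card (attach_nbh v); rewrite card_attach /at_ d0.
  by rewrite leqn0 muln_eq0 => /orP[/eqP->//|/eqP]; lia.
have sumQ : \sum_(v in cover P) (v \in low A) <=
    \sum_(v in A) at_ v * (if v \in cover P then q.-2 else q.-1)
    + \sum_(v in cover P) bottom v.
  rewrite (sum_cover _ pP) (sum_cover (fun v => bottom v) pP).
  have -> : \sum_(v in A) at_ v * (if v \in cover P then q.-2 else q.-1) =
     \sum_(Q in P) \sum_(v in A) attached Q v * (if v \in cover P then q.-2 else q.-1).
    rewrite [RHS]exchange_big /=; apply: eq_bigr => v _; rewrite -big_distrl /=.
    congr (_ * _); rewrite /at_ -sum1_card [LHS](eq_bigl (fun Q => (Q \in P) && attached Q v)).
      by rewrite big_mkcondr /=; apply: eq_bigr => Q _; case: (attached Q v).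
    by move=> Q; rewrite inE.
  rewrite -big_split; apply: leq_sum => Q QP.
  apply: leq_trans (clique_load QP).
  rewrite -sum1_card [leqRHS](eq_bigl (fun v => (v \in Q) && (v \in low A))).
    by rewrite [leqRHS]big_mkcondr; apply: leq_sum => v _; case: (v \in low A).
  by move=> v; rewrite inE.
have sP := cover_sub pP.
rewrite (sum_setD _ sP) in sumQ.
rewrite /degsum (sum_setD _ sP).
have E1 : \sum_(v in A :\: cover P) at_ v * (if v \in cover P then q.-2 else q.-1)
        = \sum_(v in A :\: cover P) at_ v * q.-1.
  by apply: eq_bigr => v /setDP[_ /negbTE->].
have E2 : \sum_(v in cover P) at_ v * (if v \in cover P then q.-2 else q.-1)
        = \sum_(v in cover P) at_ v * q.-2.
  by apply: eq_bigr => v ->.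
rewrite E1 E2 in sumQ; move: sumC; rewrite !big_split /= sum_nat_const (card_cover pP).
lia.
Qed.

End Irreducible.

(** Induction on [s]: deleting a [q]-clique [B], which is [N[y]] minus [z], with degrees at least
    [q] lowers the degree sum by at least [2q^2 - q(q-1) = q(q+1)]. Without a possible deletion,
    discharging is already strict; otherwise the extra condition puts a vertex of degree above [q]
    into [B]. *)
Lemma degsum_heavy (x0 : T) A s : robust e q A s ->
  s * q * q.+1 <= degsum A /\
  (0 < s -> {in low A, forall y, #|low A :&: cnbh A y| < q} ->
   s * q * q.+1 < degsum A).
Proof.
elim: s A => [|s IH] A gA; first by [].
have [/exists_inP[y ly /andP[cy /exists_inP[z zN /forall_inP hz]]]|red] := boolP
  [exists y in low A, (1 < #|low A :&: cnbh A y|) &&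
   [exists z in cnbh A y,
     [forall v in cnbh A y, (v != z) ==> (#|nbh A v| < q.-1 + q)]]].
- set B := cnbh A y :\ z.
  have sN := cnbh_sub e (low_sub ly).
  have sB : B \subset A := subset_trans (subsetDl _ _) sN.
  have cN := cnbh_clique e_sym q_gt2 gA ly.
  have cB : clique e B by apply: cliqueS cN; apply: subsetDl.
  have qB : #|B| = q.
    by have := cardsD1 z (cnbh A y); rewrite zN (card_cnbh e_irr ly) => -[].
  have gA1 : robust e q (A :\: B) s.
    apply: (robust_reduce e_sym e_irr q_gt2 gA ly cy zN) => v vN nvz.
    by have := hz v vN; rewrite nvz.
  have [wk _] := IH _ gA1.
  have := degsumD e_sym sB; rewrite (degsum_clique e_sym e_irr cB) qB.
  have dB v : v \in B -> q <= #|nbh A v|.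
    move=> vB; have <- : #|cnbh A y :\ v| = q.
      have vN : v \in cnbh A y by case/setD1P: vB.
      by have := cardsD1 v (cnbh A y); rewrite vN (card_cnbh e_irr ly) => -[].
    by apply/subset_leq_card/clique_sub_nbh => //; case/setD1P: vB.
  have sumB : q * q <= \sum_(v in B) #|nbh A v|.
    by rewrite -{1}qB -sum_nat_const; apply: leq_sum => v; apply: dB.
  move=> eqs; split=> [|_ hc]; first nia.
  suff : q * q < \sum_(v in B) #|nbh A v| by nia.
  have : 0 < #|B :\: low A|.
    have := hc y ly; rewrite -(setD1K zN) -/B => hB.
    have : #|B :&: low A| < q.
      apply: leq_ltn_trans hB; apply: subset_leq_card; rewrite setIC.
      by apply: setIS; apply: subsetUr.
    by have := cardsID (low A) B; rewrite qB; lia.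
  case/card_gt0P=> u /setDP[uB nlu].
  have du : q < #|nbh A u|.
    rewrite ltn_neqAle dB // andbT eq_sym; move: nlu.
    by rewrite inE (subsetP sB u uB).
  rewrite (bigD1 u) //=; 
  have : \sum_(v in B | v != u) q <= \sum_(v in B | v != u) #|nbh A v|.
    by apply: leq_sum => v /andP[vB _]; apply: dB.
  have : q * q = q + \sum_(v in B | v != u) q.
    by rewrite -{1}qB -sum_nat_const (bigD1 u).
  lia.
- suff lt : s.+1 * q * q.+1 < degsum A by split=> [|_ _]; [apply: ltnW|].
  have irr y z : y \in low A -> 1 < #|low A :&: cnbh A y| -> z \in cnbh A y ->
    exists v, [/\ v \in cnbh A y, v != z & q.-1 + q <= #|nbh A v|].
    move=> ly cy zN; move: red; rewrite negb_exists_in => /forall_inP/(_ y ly).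
    rewrite cy negb_exists_in => /forall_inP/(_ z zN).
    rewrite negb_forall_in => /exists_inP[v vN]; rewrite negb_imply => /andP[nvz].
    by rewrite -leqNgt => dv; exists v.
  have [v0 v0A d0] : exists2 v0, v0 \in A & 0 < #|nbh A v0|.
    have [P pP _] := gA.2 x0.
    have /card_gt0P[Q QP] : 0 < #|P| by rewrite (pk_card pP).
    have /card_gt0P[v0 v0Q] : 0 < #|Q| by rewrite (pk_size pP QP).
    exists v0; first exact: (subsetP (pk_sub pP QP)).
    apply: leq_trans (subset_leq_card (clique_sub_nbh (pk_sub pP QP) (pk_clique pP QP) v0Q)).
    by have := cardsD1 v0 Q; rewrite v0Q (pk_size pP QP); lia.
  have [P pP nv0] := gA.2 v0.
  exact: (irreducible_degsum gA pP irr v0A nv0 d0).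
Qed.

End Discharging.

(** * Components isomorphic to the complete graph on q + 1 vertices *)

Section Components.

Variables (T : finType) (e : rel T) (q : nat).
Hypotheses (e_sym : symmetric e) (e_irr : irreflexive e) (q_gt1 : 1 < q).
Let q_gt0 : 0 < q := ltnW q_gt1.

Implicit Types (A B N Q : {set T}) (P : {set {set T}}).

Local Notation nbh := (nbh e).
Local Notation degsum := (degsum e).

(** The equality of neighbourhoods says at once that [B] is a clique and that no edge inside [A]
    leaves it, so [B] spans a component [K_(q+1)]. *)
Definition component A B :=
  [&& B \subset A, #|B| == q.+1 & [forall u in B, nbh A u == B :\ u]].

Lemma componentP A B : reflect
  [/\ B \subset A, #|B| = q.+1 & {in B, forall u, nbh A u = B :\ u}]
  (component A B).
Proof.
apply: (iffP and3P) => -[sB cB hB]; split=> //.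
- exact/eqP.
- by move=> u uB; apply/eqP; apply: (forall_inP hB).
- exact/eqP.
- by apply/forall_inP => u uB; apply/eqP/hB.
Qed.

Lemma component_clique A B : component A B -> clique e B.
Proof.
case/componentP=> sB _ hB u v uB vB nuv.
have : v \in nbh A u by rewrite hB // in_setD1 eq_sym nuv.
by rewrite in_nbh => /andP[].
Qed.

Lemma component_closed A B u v : component A B ->
  u \in B -> v \in A -> e u v -> v \in B.
Proof.
case/componentP=> sB _ hB uB vA euv.
have : v \in nbh A u by rewrite in_nbh vA.
by rewrite hB // => /setD1P[].
Qed.

Lemma component_setD A B B' : component A B -> component (A :\: B) B' ->
  component A B'.
Proof.
move=> cB /componentP[sB' cB' hB']; apply/componentP; split=> //.
  exact: subset_trans sB' (subsetDl _ _).
move=> u uB'; have /setDP[uA nuB] := subsetP sB' u uB'.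
rewrite -hB' //; apply/setP => v; rewrite !in_nbh in_setD.
have [vB|//] := boolP (v \in B); apply/negbTE; rewrite negb_and.
apply/orP; right; apply: contra nuB => euv.
by apply: (component_closed cB vB uA); rewrite e_sym.
Qed.

(** A clique of the packing meeting [B] lies inside [B], where two disjoint ones would need
    [2q > q + 1] vertices. At least one occurs, since two adjacent vertices cannot both be
    missed. *)
Lemma component_packing A B s P : robust e q A s -> component A B ->
  packing e q A s P ->
  exists2 Q, Q \in P & {in P, forall R, R != Q -> R \subset A :\: B}.
Proof.
move=> gA cB pP; have [sB kB hB] := componentP _ _ cB.
have clB := component_clique cB.
have inB R b : R \in P -> b \in R -> b \in B -> R \subset B.
  move=> RP bR bB; rewrite -(setD1K bR) subUset sub1set bB.
  apply: subset_trans (_ : nbh A b \subset B); last by rewrite hB // subsetDl.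
  by apply: clique_sub_nbh; [apply: (pk_sub pP)|apply: (pk_clique pP)|].
have [b0 [b1 [b0B b1B n01]]] : exists b0, exists b1, [/\ b0 \in B, b1 \in B & b0 != b1].
  by apply/card_gt1P; rewrite kB; lia.
have [b bB /coverP[Q QP bQ]] : exists2 b, b \in B & b \in cover P.
  have [c0|nc0] := boolP (b0 \in cover P); first by exists b0.
  exists b1 => //; apply: (covered_of_adj gA pP _ _ _ nc0).
  - exact: (subsetP sB).
  - exact: (subsetP sB).
  - by apply: clB; rewrite // eq_sym.
exists Q => // R RP nRQ; apply/subsetP => x xR.
rewrite in_setD (subsetP (pk_sub pP RP)) // andbT; apply/negP => xB.
have sQB := inB Q b QP bQ bB; have sRB := inB R x RP xR xB.
have : [disjoint Q & R].
  have /trivIsetP := disjoint_family_trivI (pk_disj pP).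
  by apply=> //; rewrite eq_sym.
rewrite -setI_eq0 => /eqP QR0.
have := cardsUI Q R; rewrite QR0 cards0 (pk_size pP QP) (pk_size pP RP).
have : #|Q :|: R| <= #|B| by rewrite subset_leq_card // subUset sQB.
by rewrite kB; clear -q_gt1; lia.
Qed.

Lemma robust_component A B s : robust e q A s.+1 -> component A B ->
  robust e q (A :\: B) s.
Proof.
move=> gA cB; have [sB kB hB] := componentP _ _ cB.
have clB := component_clique cB.
split=> [P u v pP /setDP[uA nuB] /setDP[vA nvB] nu nv|w].
  have /card_gt0P[b bB] : 0 < #|B| by rewrite kB.
  have sBb : B :\ b \subset B := subsetDl _ _.
  have pP' : packing e q A s.+1 ((B :\ b) |: P).
    apply: (packing_add q_gt0 pP).
    - exact: subsetDl.
    - exact: subset_trans sBb sB.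
    - exact: cliqueS clB.
    - by have := cardsD1 b B; rewrite bB kB => -[].
    - move=> x /(subsetP sBb) xB; apply/negP => /(subsetP (cover_sub pP)).
      by rewrite in_setD xB.
  apply: (gA.1 _ _ _ pP' uA vA); rewrite coverU1 in_setU negb_or ?nu ?nv andbT.
    by apply: contra nuB; apply: (subsetP sBb).
  by apply: contra nvB; apply: (subsetP sBb).
have [P pP nw] := gA.2 w; have [Q QP sub] := component_packing gA cB pP.
exists (P :\ Q); first exact: (packing_rem pP QP).
by rewrite (cover_rem pP QP) in_setD (negbTE nw) andbF.
Qed.

Lemma robust0_indep A : robust e q A 0 -> {in A &, forall u v, ~~ e u v}.
Proof.
move=> gA u v uA vA; apply: (gA.1 set0) => //; rewrite ?/cover ?big_set0 ?inE //.
by split=> [|Q|Q|Q|Q Q' x]; rewrite ?cards0 // inE.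
Qed.

Lemma degsum_component A B : component A B ->
  degsum A = degsum (A :\: B) + q * q.+1.
Proof.
move=> cB; have [sB kB hB] := componentP _ _ cB.
have := degsumD e_sym sB.
rewrite (degsum_clique e_sym e_irr (component_clique cB)) kB /=.
rewrite (eq_bigr (fun=> q)) ?sum_nat_const ?kB => [|u uB]; last first.
  by rewrite hB //; have := cardsD1 u B; rewrite uB kB => -[].
lia.
Qed.

(** Each removed component lowers [s] by one, and at [s = 0] the remaining set is independent, so no
    component can be left. *)
Lemma strip_components A s : robust e q A s -> exists BB : {set {set T}},
  [/\ #|BB| <= s, {in BB, forall B, component A B},
      robust e q (A :\: cover BB) (s - #|BB|),
      forall B, ~~ component (A :\: cover BB) B &
      degsum A = #|BB| * (q * q.+1) + degsum (A :\: cover BB)].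
Proof.
elim: s A => [|s IH] A gA.
  exists set0; rewrite cards0 /cover big_set0 setD0; split=> // B.
    by rewrite inE.
  apply/negP => cB; have [sB kB _] := componentP _ _ cB.
  have /card_gt1P[b0 [b1 [b0B b1B n01]]] : 1 < #|B| by rewrite kB; lia.
  have := robust0_indep gA (subsetP sB _ b0B) (subsetP sB _ b1B).
  by rewrite (component_clique cB).
have [/existsP[B cB]|nc] := boolP [exists B, component A B]; last first.
  exists set0; rewrite cards0 /cover big_set0 setD0 subn0; split=> // B.
    by rewrite inE.
  by move: nc; rewrite negb_exists => /forallP.
have [BB [kBB hBB gBB nBB dBB]] := IH _ (robust_component gA cB).
have nB : B \notin BB.
  apply/negP => /hBB /componentP[sB kB _].
  have /card_gt0P[b bB] : 0 < #|B| by rewrite kB.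
  by have := subsetP sB b bB; rewrite in_setD bB.
have cU : cover (B |: BB) = B :|: cover BB by rewrite coverU1.
exists (B |: BB); rewrite cardsU1 nB cU -setDDl add1n subSS; split=> //.
  by move=> B' /setU1P[->//|/hBB]; apply: component_setD.
by rewrite (degsum_component cB) dBB; lia.
Qed.

Lemma nbh_components A (BB : {set {set T}}) v :
    {in BB, forall B, component A B} -> v \in A :\: cover BB ->
  nbh (A :\: cover BB) v = nbh A v.
Proof.
move=> hBB /setDP[vA nvB]; apply/setP => u; rewrite !in_nbh in_setD.
have [/coverP[B BBB uB]|//] := boolP (u \in cover BB).
apply/esym/negbTE/andP => -[_ evu]; case/negP: nvB; apply/coverP; exists B => //.
by apply: (component_closed (hBB B BBB) uB vA); rewrite e_sym.
Qed.

Lemma components_disjoint A (BB : {set {set T}}) :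
  {in BB, forall B, component A B} -> disjoint_family BB.
Proof.
move=> hBB B B' x BBB B'BB xB xB'.
have [sB kB hB] := componentP _ _ (hBB B BBB).
have [sB' kB' hB'] := componentP _ _ (hBB B' B'BB).
by rewrite -(setD1K xB) -(setD1K xB') -hB // hB'.
Qed.

End Components.

(** * Copies of the forbidden graph as families of cliques *)

Section Shapes.

Variables (T : finType) (p q s : nat).
Hypothesis p_le_q : p <= q.

Implicit Types (A C X : {set T}) (F : {set {set T}}) (e : rel T).

(** The vertex sets of the pieces of a copy of [K_p] and [s] copies of [K_q]. For [p = q] the member
    [C] is not determined, so the lemmas below argue by sizes. *)
Record copy_shape F : Prop := CopyShape {
  cs_card : #|F| = s.+1;
  cs_disj : disjoint_family F;
  cs_size : exists2 C, C \in F & #|C| = p /\ {in F, forall X, X != C -> #|X| = q} }.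

Definition copy_family e F := copy_shape F /\ {in F, forall X, clique e X}.

Lemma copy_shape_ge F C : copy_shape F -> C \in F -> p <= #|C|.
Proof.
case=> _ _ [C0 C0F [kC0 hq]] CF; have [->|nC] := eqVneq C C0.
  by rewrite kC0.
by rewrite hq.
Qed.

Lemma copy_shape_le F C : copy_shape F -> C \in F -> #|C| <= q.
Proof.
case=> _ _ [C0 C0F [kC0 hq]] CF; have [->|nC] := eqVneq C C0.
  by rewrite kC0.
by rewrite hq.
Qed.

Lemma copy_shape_ge2 F C C' : copy_shape F -> C \in F -> C' \in F -> C != C' ->
  p + q <= #|C| + #|C'|.
Proof.
move=> sF CF C'F nCC'; have [_ _ [C0 C0F [kC0 hq]]] := sF.
have := copy_shape_ge sF CF; have := copy_shape_ge sF C'F.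
have [CC0|nC] := eqVneq C C0; last by rewrite (hq C) //; lia.
by rewrite (hq C') // -?CC0 1?eq_sym //; lia.
Qed.

Lemma copy_shape_rem1 F C : copy_shape F -> C \in F -> #|C| <= p ->
  {in F, forall X, X != C -> #|X| = q}.
Proof.
case=> _ _ [C0 C0F [kC0 hq]] CF kC X XF nXC.
have [CC0|nC] := eqVneq C C0; first by rewrite hq // -CC0.
by have := hq C CF nC; have [->|/hq->//] := eqVneq X C0; lia.
Qed.

(** If some other [X] is the member of size [p], then [C] and [C'] both have size [q], which forces
    [p = q]. *)
Lemma copy_shape_rem2 F C C' : copy_shape F -> C \in F -> C' \in F -> C != C' ->
  #|C| + #|C'| <= p + q -> {in F, forall X, X != C -> X != C' -> #|X| = q}.
Proof.
case=> _ _ [C0 C0F [kC0 hq]] CF C'F nCC' kCC' X XF nXC nXC'.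
have [XC0|/hq->//] := eqVneq X C0.
have kC : #|C| = q by rewrite hq // -XC0 eq_sym.
have kC' : #|C'| = q by rewrite hq // -XC0 eq_sym.
by rewrite XC0; lia.
Qed.

Hypothesis p_gt0 : 0 < p.

Lemma copy_shape_replace F C C' : copy_shape F -> C \in F -> #|C'| = #|C| ->
    (forall x X, x \in C' -> X \in F -> x \in X -> X = C) ->
  copy_shape (C' |: (F :\ C)).
Proof.
move=> sF CF kC' dC'; have C_gt0 : 0 < #|C'|.
  by rewrite kC'; apply: leq_trans p_gt0 (copy_shape_ge sF CF).
have nC' : C' \notin F :\ C.
  apply/negP => /setD1P[nC'C C'F]; case/card_gt0P: C_gt0 => x xC'.
  by rewrite (dC' x C') ?eqxx in nC'C.
have [kF dF [C0 C0F [kC0 hq]]] := sF; split.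
- by rewrite cardsU1 nC'; have := cardsD1 C F; rewrite CF kF.
- move=> X X' x /setU1P[->|/setD1P[nX XF]] /setU1P[->|/setD1P[nX' X'F]] // xX xX'.
  + by rewrite (dC' x X') ?eqxx in nX'.
  + by rewrite (dC' x X) ?eqxx in nX.
  + exact: (dF _ _ x).
- have [CC0|nCC0] := eqVneq C C0.
    exists C'; rewrite ?setU11 // kC' CC0; split=> // X.
    by case/setU1P=> [->|/setD1P[nX XF] _]; rewrite ?eqxx // hq.
  exists C0; first by rewrite setU1r // in_setD1 eq_sym nCC0.
  split=> // X /setU1P[-> _|/setD1P[nX XF]]; last exact: hq.
  by rewrite kC' hq.
Qed.

Lemma copy_shape_add e A P C : packing e q A s P -> #|C| = p ->
  {in C, forall x, x \notin cover P} -> copy_shape (C |: P).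
Proof.
move=> pP kC dC.
have nC : C \notin P.
  apply/negP => CP; have /card_gt0P[x xC] : 0 < #|C| by rewrite kC.
  by case/coverP: (dC x xC); exists C.
split.
- by rewrite cardsU1 nC (pk_card pP).
- move=> X X' x /setU1P[->|XP] /setU1P[->|X'P] // xX xX'.
  + by case/coverP: (dC x xX); exists X'.
  + by case/coverP: (dC x xX'); exists X.
  + exact: (pk_disj pP) xX xX'.
- exists C; rewrite ?setU11 //; split=> // X /setU1P[->|XP _].
    by rewrite eqxx.
  exact: (pk_size pP).
Qed.

Lemma copy_family_add e A P C : packing e q A s P -> clique e C -> #|C| = p ->
  {in C, forall x, x \notin cover P} -> copy_family e (C |: P).
Proof.
move=> pP cC kC dC; split; first exact: copy_shape_add pP kC dC.
by move=> X /setU1P[->//|]; apply: (pk_clique pP).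
Qed.

End Shapes.

(** * Saturated graphs *)

(** Here [a = p - 2], [d] is the minimum degree, [M] stands for [s * q * (q + 1)] and [S] for the
    degree sum; the conclusion says that [S] exceeds the degree sum of the extremal graph. *)
Lemma min_degree_arith a d n M S : a < d -> d <= 2 * a -> d <= M + a ->
  M + 3 * a < n -> 2 * d + a * a.-1 + (a + d) * (n - d.+1) <= S ->
  2 * a * n + M < S + a * a.+1.
Proof.
move=> a_lt_d d_le dM hn.
have [k dk] : exists k, d = a.+1 + k by exists (d - a.+1); lia.
have [c ac] : exists c, a = k.+1 + c by exists (a - k.+1); lia.
have [m nm] : exists m, n = M + 3 * a + 1 + m by exists (n - (M + 3 * a + 1)); lia.
have kM : k * k <= k * M by rewrite leq_mul2l; lia.
have -> : n - d.+1 = M + k + 1 + 2 * c + m by lia.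
rewrite {}nm {}dk {}ac addSn /= in hn a_lt_d d_le dM *.
nia.
Qed.

Section Saturated.

Variables (T : finType) (e : rel T) (p q s : nat).
Hypotheses (e_sym : symmetric e) (e_irr : irreflexive e).
Hypotheses (p_gt1 : 1 < p) (p_le_q : p <= q).
Let p_gt0 : 0 < p := ltnW p_gt1.
Let q_gt1 : 1 < q := leq_trans p_gt1 p_le_q.
Let q_gt0 : 0 < q := ltnW q_gt1.

Implicit Types (A B C N Q U X : {set T}) (P F : {set {set T}}).

Local Notation nbh := (nbh e).
Local Notation degsum := (degsum e).
Local Notation universal := (universal e).
Local Notation deg v := #|nbh setT v|.

(** The trace in [G] of a copy in [G + xy]: all pairs inside members are adjacent, except possibly
    [x] and [y] in [C]. *)
Record near_copy x y F C : Prop := NearCopy {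
  nc_shape : copy_shape p q s F;
  nc_mem : C \in F;
  nc_x : x \in C;
  nc_y : y \in C;
  nc_others : {in F, forall X, X != C -> clique e X};
  nc_cliqueDx : clique e (C :\ x);
  nc_cliqueDy : clique e (C :\ y) }.

Hypothesis nocopy : forall F, ~ copy_family p q s e F.
Hypothesis satur : forall x y, x != y -> ~~ e x y ->
  exists F, exists C, near_copy x y F C.

Lemma in_deg u v : (u \in nbh setT v) = e v u.
Proof. by rewrite in_nbh inE. Qed.

(** The witness is the member [C] of a near copy without [x] and [y]; [C] has at least [p]
    vertices. *)
Lemma common_nbrs x y : x != y -> ~~ e x y ->
  exists X, [/\ clique e X, X \subset nbh setT x, X \subset nbh setT y & p.-2 <= #|X|].
Proof.
move=> nxy nexy; have [F [C [sF CF xC yC _ cx cy]]] := satur nxy nexy.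
exists (C :\ x :\ y); split.
- exact: cliqueS (subsetDl _ _) cx.
- apply/subsetP => u /setD1P[nuy /setD1P[nux uC]]; rewrite in_deg.
  by apply: cy; rewrite ?in_setD1 ?nxy ?nuy // eq_sym.
- apply/subsetP => u /setD1P[nuy /setD1P[nux uC]]; rewrite in_deg.
  by apply: cx; rewrite ?in_setD1 ?nux ?(eq_sym y) ?nxy // eq_sym.
- have := copy_shape_ge p_le_q sF CF.
  have := cardsD1 x C; rewrite xC => ->.
  by have := cardsD1 y (C :\ x); rewrite in_setD1 eq_sym nxy yC; lia.
Qed.

(** If [d > 2a], the bound [d * #|T|] suffices. Otherwise let [B] be [N[x]]: a vertex outside has
    degree at least [d] and, by [common_nbrs], at least [a] neighbours in [B]; inside [B] the edges
    at [x] and a clique [X] of at least [a] neighbours contribute [2d + a(a-1)]. *)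
Lemma degsum_high_min_degree x : (forall v, deg x <= deg v) -> p.-2 < deg x ->
    0 < s -> q * q.+1 * s + 3 * p.-2 < #|T| ->
  2 * p.-2 * #|T| + s * (q * q.+1) < degsum setT + p.-2 * p.-1.
Proof.
set a := p.-2; set d := deg x => xmin d_gt s_gt0 hn.
have [d_hi|d_lo] := ltnP (2 * a) d.
  have : \sum_(v in [set: T]) d <= degsum setT by apply: leq_sum => v _; apply: xmin.
  rewrite sum_nat_const cardsT => h.
  have : #|T| * (2 * a).+1 <= #|T| * d by rewrite leq_mul2l d_hi orbT.
  nia.
pose B := x |: nbh setT x.
have kB : #|B| = d.+1 by rewrite cardsU1 in_deg e_irr.
have kBc : #|setT :\: B| = #|T| - d.+1 by rewrite cardsDS ?subsetT // cardsT kB.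
have out y : y \in setT :\: B -> y != x /\ ~~ e x y.
  by rewrite !inE andbT negb_or => /andP[].
have hd : d.+1 < #|T|.
  have : q * q.+1 * 1 <= q * q.+1 * s by rewrite leq_mul2l s_gt0 orbT.
  by move: p_le_q; rewrite /a in d_lo hn; nia.
have [y0 y0B] : exists y0, y0 \in setT :\: B by apply/card_gt0P; rewrite kBc subn_gt0.
have [X [cX Xx _ kX]] : exists X, [/\ clique e X, X \subset nbh setT x,
    X \subset nbh setT y0 & a <= #|X|].
  by have [n1 n2] := out _ y0B; apply: common_nbrs => //; rewrite eq_sym.
have sBc : a * (#|T| - d.+1) <= \sum_(v in setT :\: B) #|nbh B v|.
  rewrite -kBc mulnC -sum_nat_const; apply: leq_sum => y yB.
  have [nyx nxy] := out _ yB; have := @common_nbrs x y; rewrite eq_sym.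
  case=> // Y [_ Yx Yy kY]; apply: leq_trans kY _; apply: subset_leq_card.
  apply/subsetP => u uY; rewrite in_nbh setU1r ?(subsetP Yx) //=.
  by rewrite -in_deg (subsetP Yy).
have sB : 2 * d + a * a.-1 <= degsum B.
  rewrite /degsum big_setU1 ?in_deg ?e_irr //=.
  have -> : nbh B x = nbh setT x.
    apply/setP => u; rewrite in_deg in_nbh andbC; apply: andb_idr => exu.
    by rewrite setU1r // in_deg.
  rewrite mul2n -addnn -addnA leq_add2l.
  have : \sum_(v in nbh setT x) (1 + (v \in X) * #|X|.-1) <=
         \sum_(v in nbh setT x) #|nbh B v|.
    apply: leq_sum => v vx; have exv : e x v by rewrite -in_deg.
    have xv : x \in nbh B v by rewrite in_nbh setU11 e_sym.
    have [vX|_] := boolP (v \in X); last by rewrite addn0; apply/card_gt0P; exists x.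
    have -> : 1 + true * #|X|.-1 = #|x |: (X :\ v)|.
      rewrite cardsU1 in_setD1 negb_and; have -> : x \notin X.
        by apply/negP => /(subsetP Xx); rewrite in_deg e_irr.
      by rewrite orbT mul1n; have := cardsD1 v X; rewrite vX => ->.
    apply: subset_leq_card; rewrite subUset sub1set xv.
    apply/subsetP => u /setD1P[nuv uX]; rewrite in_nbh setU1r ?(subsetP Xx) //=.
    by apply: cX; rewrite // eq_sym.
  rewrite big_split /= sum1_card -/d -big_distrl /=.
  have -> : \sum_(v in nbh setT x) (v \in X) = #|X|.
    rewrite -big_mkcondr /= -sum1_card; apply: eq_bigl => v.
    by apply: andb_idl; apply: (subsetP Xx).
  by apply: leq_trans; rewrite leq_add2l leq_mul //; lia.
have eqs := sum_setD (fun v => deg v) (subsetT B); rewrite -/(degsum setT) in eqs.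
have h1 : d * (#|T| - d.+1) <= \sum_(v in setT :\: B) deg v.
  by rewrite -kBc mulnC -sum_nat_const; apply: leq_sum => v _; apply: xmin.
have h2 : \sum_(v in B) deg v = \sum_(v in setT :\: B) #|nbh B v| + degsum B.
  under eq_bigr => v _ do rewrite (card_nbhD _ _ (subsetT B)).
  by rewrite big_split sum_nbhC.
have : 2 * d + a * a.-1 + (a + d) * (#|T| - d.+1) <= degsum setT.
  by rewrite eqs h2; lia.
move=> h; have -> : p.-1 = a.+1 by rewrite /a; lia.
apply: (min_degree_arith d_gt d_lo _ _ h); last by lia.
by rewrite /a in d_lo; nia.
Qed.

Lemma copy_shape_packing F C A : copy_shape p q s F -> C \in F ->
    {in F, forall X, X != C -> [/\ clique e X, X \subset A & #|X| = q]} ->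
  packing e q A s (F :\ C).
Proof.
case=> kF dF _ CF hF; split=> [|X|X|X|X X' x].
- by have := cardsD1 C F; rewrite CF kF => -[].
- by case/setD1P=> nX XF; have [] := hF X XF nX.
- by case/setD1P=> nX XF; have [] := hF X XF nX.
- by case/setD1P=> nX XF; have [] := hF X XF nX.
- by move=> /setD1P[_ XF] /setD1P[_ X'F]; apply: dF.
Qed.

(** The common neighbours of [x] and any nonneighbour must fill the neighbourhood [U] of [x], which
    makes [U] a clique of size [p - 2] joined to everything. An edge missed by a packing would
    complete [U] to a [K_p], and the near copies of nonedges at [x] supply the packings of the
    second property. *)
Lemma universal_min_degree x : deg x <= p.-2 -> p.-1 < #|T| ->
  exists U, [/\ #|U| = p.-2, universal U & robust e q (~: U) s].
Proof.
set U := nbh setT x => dx hT; exists U.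
have kxU : #|x |: U| = #|U|.+1 by rewrite cardsU1 in_deg e_irr.
have [y0 y0U] : exists y0, y0 \in ~: (x |: U).
  by apply/card_gt0P; rewrite cardsCs setCK kxU subn_gt0; lia.
have out y : y \in ~: (x |: U) -> x != y /\ ~~ e x y.
  by rewrite !inE negb_or eq_sym => /andP[].
have nbU y : y \in ~: (x |: U) ->
    [/\ clique e U, U \subset nbh setT y & #|U| = p.-2].
  case/out=> nxy nexy; have [X [cX Xx Xy kX]] := common_nbrs nxy nexy.
  have <- : X = U by apply/eqP; rewrite eqEcard Xx; lia.
  by split=> //; have := subset_leq_card Xx; rewrite -/U; lia.
have [cU _ kU] := nbU _ y0U.
have uU : universal U.
  move=> u v uU nvu; have [vU|nvU] := boolP (v \in U); first by apply: cU; rewrite // eq_sym.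
  have [->|nvx] := eqVneq v x; first by rewrite e_sym -in_deg.
  have [|_ sU _] := nbU v; first by rewrite !inE negb_or nvx -in_deg.
  by rewrite e_sym -in_deg (subsetP sU).
split=> //; split=> [P u v pP|w].
  rewrite !in_setC => nuU nvU nu nv; apply/negP => euv.
  apply: (nocopy (F := (u |: (v |: U)) |: P)).
  apply: (copy_family_add p_gt0 pP).
  - apply: cliqueU1 => //; first apply: cliqueU1 => //.
    + by move=> z zU nzv; rewrite e_sym; apply: uU; rewrite // eq_sym.
    + move=> z /setU1P[->//|zU] nzu.
      by rewrite e_sym; apply: uU; rewrite // eq_sym.
  - by rewrite !cardsU1 in_setU1 negb_or nvU nuU (neq_of_adj e_irr euv) kU; lia.
  - move=> z /setU1P[->//|/setU1P[->//|zU]]; apply/negP => /(subsetP (cover_sub pP)).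
    by rewrite in_setC zU.
(* The member [C] turns out to be [U] together with [x] and [y]. With this choice of [y] it contains
   [w] in all cases, so the other members miss [w]. *)
pose y := if w \in ~: (x |: U) then w else y0.
have yU : y \in ~: (x |: U) by rewrite /y; case: ifP.
have [nxy nexy] := out y yU.
have [F [C [sF CF xC yC oth cx cy]]] := satur nxy nexy.
have sC : C \subset y |: (x |: U).
  apply/subsetP => u uC; have [->|nuy] := eqVneq u y; first by rewrite setU11.
  have [->|nux] := eqVneq u x; first by rewrite setU1r // setU11.
  rewrite setU1r // setU1r // in_deg.
  by apply: cy; rewrite ?in_setD1 ?nxy ?nuy // eq_sym.
have kC : #|y |: (x |: U)| = p.
  by rewrite cardsU1 -in_setC yU kxU kU; lia.
have EC : C = y |: (x |: U).
  by apply/eqP; rewrite eqEcard sC kC (copy_shape_ge p_le_q sF CF).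
have disj u X : u \in C -> X \in F -> X != C -> u \notin X.
  move=> uC XF nXC; apply: contra nXC => uX.
  by apply/eqP; apply: (cs_disj sF XF CF uX uC).
have pP : packing e q (~: U) s (F :\ C).
  apply: copy_shape_packing => // X XF nXC; split.
  - exact: oth.
  - apply/subsetP => u uX; rewrite in_setC; apply/negP => uU'.
    have uC : u \in C by rewrite EC !setU1r.
    by have := disj u X uC XF nXC; rewrite uX.
  - by apply: (copy_shape_rem1 p_le_q sF CF); rewrite // EC kC.
exists (F :\ C) => //.
have [wC|nwC] := boolP (w \in C).
  apply/negP => /coverP[X /setD1P[nXC XF] wX].
  by have := disj w X wC XF nXC; rewrite wX.
case/negP: nwC; rewrite EC.
by have [wU|] := boolP (w \in ~: (x |: U)); [rewrite /y wU setU11 | rewrite in_setC negbK => /setU1r->].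
Qed.

(* Gallai's argument: M misses u and w; any packing missing v can be changed into one
   that still misses v and shares one more edge with M, which cannot go on forever. *)
Lemma matching_adj_trans u v w : q = 2 -> robust e q setT s ->
  u != w -> e u v -> e v w -> e u w.
Proof.
move=> q2 gT nuw euv evw; apply/negPn/negP => neuw.
have [F [C [sF CF uC wC oth _ _]]] := satur nuw neuw.
have kC : #|C| = p.
  have := copy_shape_le p_le_q sF CF; have := copy_shape_ge p_le_q sF CF.
  by clear -p_gt1 q2; lia.
pose M := F :\ C.
have pM : packing e q setT s M.
  apply: copy_shape_packing => // X XF nXC; split; [exact: oth|exact: subsetT|].
  by apply: (copy_shape_rem1 p_le_q sF CF); rewrite ?kC.
have nM x : x \in C -> x \notin cover M.
  move=> xC; apply/negP => /coverP[X /setD1P[nXC XF] xX].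
  by rewrite (cs_disj sF XF CF xX xC) eqxx in nXC.
have vM : v \in cover M.
  by apply: (covered_of_adj gT pM) (nM u uC); rewrite ?inE // e_sym.
have [N0 pN0 nv0] := gT.2 v.
have [k] := ubnP (s - #|M :&: N0|).
elim: k N0 pN0 nv0 => // k IH N0 pN nv lt_k.
have uN : u \in cover N0 by apply: (covered_of_adj gT pN) nv; rewrite ?inE.
have wN : w \in cover N0 by apply: (covered_of_adj gT pN) nv; rewrite ?inE // e_sym.
(* [N0] covers [u] and [w], which [M] misses, and both cover equally many vertices; hence [M] covers
   two vertices that [N0] misses, one of them not [v]. *)
have [x xMN nxv] : exists2 x, x \in cover M :\: cover N0 & x != v.
  have : 1 < #|cover M :\: cover N0|.
    have : #|[set u; w]| <= #|cover N0 :\: cover M|.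
      by rewrite subset_leq_card // subUset !sub1set !in_setD uN wN !nM.
    rewrite cards2 nuw !cardsD (card_cover pM) (card_cover pN).
    by rewrite setIC.
  case/card_gt1P=> x1 [x2 [x1D x2D n12]].
  have [x1v|nx1v] := eqVneq x1 v; last by exists x1.
  by exists x2; rewrite // -x1v eq_sym.
have /setDP[/coverP[E EM xE] nxN] := xMN.
have [y Ey] : exists y, E :\ x = [set y].
  by apply/cards1P; have := cardsD1 x E; rewrite xE (pk_size pM EM) q2 add1n => -[<-].
have /setD1P[nyx yE] : y \in E :\ x by rewrite Ey set11.
have exy : e y x by apply: (pk_clique pM EM).
have yN : y \in cover N0 by apply: (covered_of_adj gT pN) nxN; rewrite ?inE.
have /coverP[E2 E2N yE2] := yN.
have inE_ z : z \in E -> z = x \/ z = y.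
  move=> zE; have [->|nzx] := eqVneq z x; first by left.
  by right; apply/set1P; rewrite -Ey in_setD1 nzx.
(* The edge [E] of [M] at [x] replaces the edge [E2] of [N0] at its other end [y]. Then [v] stays
   missed, because [N0] covers [y] and [x] differs from [v]. *)
have pN3 : packing e q setT s (E |: (N0 :\ E2)).
  apply: (packing_replace q_gt0 pN E2N); [exact: subsetT|exact: (pk_clique pM)|exact: (pk_size pM)|].
  by move=> z /inE_[->|->]; rewrite ?(negbTE nxN).
have nv3 : v \notin cover (E |: (N0 :\ E2)).
  rewrite coverU1 (cover_rem pN E2N) in_setU in_setD (negbTE nv) andbF orbF.
  by apply/negP => /inE_[vx|vy]; [rewrite vx eqxx in nxv | rewrite vy yN in nv].
apply: (IH _ pN3 nv3).
have nE2M : E2 \notin M.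
  apply/negP => E2M; case/negP: nxN; apply/coverP; exists E2 => //.
  by rewrite (pk_disj pM E2M EM yE2 yE).
have nEN : E \notin N0 by apply/negP => EN; case/negP: nxN; apply/coverP; exists E.
have sub : E |: (M :&: N0) \subset M :&: (E |: (N0 :\ E2)).
  apply/subsetP => R /setU1P[->|/setIP[RM RN]]; first by rewrite in_setI EM setU11.
  rewrite in_setI RM setU1r // in_setD1 RN andbT.
  by apply: contraNneq nE2M => <-.
have := subset_leq_card sub; rewrite cardsU1 in_setI (negbTE nEN) andbF.
have := subset_leq_card (subsetIl M (E |: (N0 :\ E2))); rewrite (pk_card pM).
by clear -lt_k; lia.
Qed.

(** * The graph outside a universal clique of [p - 2] vertices *)

Section Structure.

Variable U : {set T}.
Hypotheses (kU : #|U| = p.-2) (uU : universal U).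

Local Notation A := (~: U).
Local Notation low := (low e q).
Local Notation cnbh := (cnbh e).

Hypothesis gA : robust e q A s.

Lemma nbh_universal u v : e u v -> v \in U \/ v \in nbh A u.
Proof. by move=> euv; rewrite in_nbh in_setC euv andbT; case: (v \in U); [left|right]. Qed.

Lemma universal_cliqueU N : clique e N -> clique e (N :|: U).
Proof.
move=> cN x y /setUP[xN|xU] /setUP[yN|yU] nxy; first exact: cN.
- by rewrite e_sym; apply: uU.
- by apply: uU; rewrite // eq_sym.
- by apply: uU; rewrite // eq_sym.
Qed.

(* In G + yw, moving w out of its clique C and rearranging N[y] :|: U shows that
   only one other clique meets it, and then N[y] minus z together with zw beats
   those two cliques. *)
Lemma pendant_clique_saturated y z w : 2 < q -> y \in low A -> z \in cnbh A y ->
  cnbh A y :\ z \subset low A -> w \in A -> w \notin cnbh A y -> ~~ e z w.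
Proof.
move=> q_gt2 ly zN lN wA nwN; apply/negP => ezw.
set N := cnbh A y in zN lN nwN *.
have yN : y \in N by rewrite setU11.
have cN : clique e N := cnbh_clique e_sym q_gt2 gA ly.
have sN : N \subset A := cnbh_sub e (low_sub ly).
have kN : #|N| = q.+1 := card_cnbh e_irr ly.
have nyw : y != w by apply: contraNneq nwN => <-.
have neyw : ~~ e y w by apply: contra nwN => eyw; rewrite setU1r // in_nbh wA.
have EN : N = cnbh A y := erefl; clearbody N.
have [F [C [sF CF yC wC oth cy cw]]] := satur nyw neyw.
have dF u X X' : X \in F -> X' \in F -> X != X' -> u \in X -> u \notin X'.
  move=> XF X'F nXX' uX; apply: contra nXX' => uX'.
  by apply/eqP; apply: (cs_disj sF XF X'F uX uX').
pose M := N :|: U.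
have cM : clique e M := universal_cliqueU cN.
have kM : #|M| = (p + q).-1.
  have NU0 : N :&: U = set0 by apply/eqP; rewrite setI_eq0 disjoints_subset.
  by rewrite cardsU NU0 cards0 kN kU; clear -p_gt1; lia.
have sCM : C :\ w \subset M.
  apply/subsetP => u /setD1P[nuw uC]; rewrite in_setU.
  have [->|nuy] := eqVneq u y; first by rewrite yN.
  have : e y u by apply: cw; rewrite ?in_setD1 ?nyw ?nuw // eq_sym.
  by case/nbh_universal=> [->|uN]; rewrite ?orbT // EN setU1r.
have kNz : #|N :\ z| = q by have := cardsD1 z N; rewrite zN kN => -[].
(* [C] contains [w] and has at most [q] vertices, so it cannot contain all [q] vertices of
   [N :\ z]. *)
have [b bN nbC] : exists2 b, b \in N :\ z & b \notin C.
  apply/subsetPn/negP => sNC.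
  have : #|w |: (N :\ z)| <= #|C| by rewrite subset_leq_card // subUset sub1set wC.
  rewrite cardsU1 in_setD1 (negbTE nwN) andbF kNz.
  by move/leq_trans/(_ (copy_shape_le p_le_q sF CF)); rewrite add1n ltnn.
have [/existsP[X /andP[XF bX]]|nb] := boolP [exists X, (X \in F) && (b \in X)]; last first.
  have bM : b \in M by rewrite in_setU; case/setD1P: bN => _ ->.
  apply: (nocopy (F := (b |: (C :\ w)) |: (F :\ C))); split.
    apply: (copy_shape_replace p_le_q p_gt0 sF CF).
      by rewrite cardsU1 in_setD1 (negbTE nbC) andbF; have := cardsD1 w C; rewrite wC.
    move=> u X /setU1P[->|/setD1P[_ uC]] XF uX.
      by case/negP: nb; apply/existsP; exists X; rewrite XF.
    exact: (cs_disj sF XF CF uX uC).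
  move=> X /setU1P[->|/setD1P[nXC XF]]; last exact: oth.
  by apply: cliqueS cM; rewrite subUset sub1set bM.
have nXC : X != C by apply: contraNneq nbC => <-.
have lb : b \in low A by apply: (subsetP lN).
have sXM : X \subset M.
  apply/subsetP => u uX; rewrite in_setU.
  have [->|nub] := eqVneq u b; first by case/setD1P: bN => _ ->.
  have : e b u by apply: (oth X) => //; rewrite eq_sym.
  case/nbh_universal=> [->|uN]; first by rewrite orbT.
  have <- : cnbh A b = N.
    by rewrite EN; apply: (cnbh_eq e_sym e_irr q_gt2 gA) => //; rewrite -EN; case/setD1P: bN.
  by rewrite setU1r.
have kXC := copy_shape_ge2 p_le_q sF XF CF nXC.
(* [X] and [C :\ w] are disjoint subsets of [M], which has [p + q - 1] vertices, while the sizes of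
   [X] and [C] add up to at least [p + q]: both bounds are tight. *)
have EM : X :|: (C :\ w) = M /\ #|X| + #|C| = p + q.
  have kC := cardsD1 w C; rewrite wC in kC.
  have X0 : X :&: (C :\ w) = set0.
    apply/setP => u; rewrite inE [RHS]inE; apply/negbTE/andP => -[uX /setD1P[_ uC]].
    by have := dF u X C XF CF nXC uX; rewrite uC.
  have kU' := cardsUI X (C :\ w); rewrite X0 cards0 in kU'.
  have sU : X :|: (C :\ w) \subset M by rewrite subUset sXM.
  have le := subset_leq_card sU; rewrite kM in le.
  split; last by clear -kC kU' le kXC p_gt1; lia.
  by apply/eqP; rewrite eqEcard sU kM; clear -kC kU' le kXC p_gt1; lia.
have [{}EM sz] := EM.
have big := copy_shape_rem2 p_le_q sF XF CF nXC; rewrite sz leqnn in big.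
have out u Y : u \in M :|: [set w] -> Y \in F -> Y != X -> Y != C -> u \notin Y.
  move=> uM YF nYX nYC; have : u \in X :|: C.
    move: uM; rewrite -EM !inE => /orP[/orP[->//|/andP[_ ->]]|/eqP->]; rewrite ?orbT //.
    by rewrite wC orbT.
  by case/setUP=> uXC; [apply: (dF u X)|apply: (dF u C)] => //; rewrite eq_sym.
have s_gt0 : 0 < s.
  have : #|[set X; C]| <= #|F|.
    by rewrite subset_leq_card // subUset !sub1set XF CF.
  by rewrite cards2 nXC (cs_card sF).
have Es : s = s.-1.+1 by rewrite prednK.
have pR : packing e q (A :\: (M :|: [set w])) s.-1 (F :\ C :\ X).
  split=> [|Y|Y|Y|Y Y' u].
  - have := cardsD1 C F; rewrite CF (cs_card sF) => -[->].
    by rewrite (cardsD1 X (F :\ C)) in_setD1 nXC XF.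
  - by case/setD1P=> nYX /setD1P[nYC YF]; apply: big.
  - case/setD1P=> nYX /setD1P[nYC YF]; apply/subsetP => u uY.
    have nuM : u \notin M :|: [set w].
      by apply/negP => /out/(_ YF nYX nYC); rewrite uY.
    rewrite in_setD nuM in_setC; apply: contra nuM => uU'.
    by rewrite !in_setU uU' orbT.
  - by case/setD1P=> nYX /setD1P[nYC YF]; apply: oth.
  - by move=> /setD1P[_ /setD1P[_ YF]] /setD1P[_ /setD1P[_ Y'F]]; apply: (cs_disj sF).
have nR u : u \in M :|: [set w] -> u \notin cover (F :\ C :\ X).
  move=> uM; apply/negP => /(subsetP (cover_sub pR)).
  by rewrite in_setD uM.
(* The other [s - 1] members avoid [M] and [w]; adding [N :\ z] gives a packing of [A] that misses
   both [z] and [w]. *)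
have pP : packing e q A s ((N :\ z) |: (F :\ C :\ X)).
  rewrite Es; apply: (packing_add q_gt0 pR) => //.
  - exact: subsetDl.
  - exact: subset_trans (subsetDl _ _) sN.
  - exact: cliqueS (subsetDl _ _) cN.
  - by move=> u /setD1P[_ uN]; apply: nR; rewrite !in_setU uN.
have := gA.1 _ z w pP; rewrite ezw !coverU1 !in_setU (subsetP sN) // wA.
rewrite !in_setD1 eqxx (negbTE nwN) andbF /= => /(_ isT isT).
by rewrite !nR ?in_setU ?zN ?set11 ?orbT // => /(_ isT isT).
Qed.

(** By [degsum_heavy] it suffices to exclude [q] vertices of degree [q] in one [N[y]]. As [N[y]] is
    no component, some [z] in it has a neighbour [w] outside; then all its vertices but [z] have
    degree [q], against [pendant_clique_saturated]. Degrees in [D] and in [A] agree, since whole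
    components were deleted. *)
Lemma degsum_no_component_heavy (x0 : T) (BB : {set {set T}}) s0 : 2 < q ->
    {in BB, forall B, component e q A B} -> 0 < s0 ->
    robust e q (A :\: cover BB) s0 ->
    (forall B, ~~ component e q (A :\: cover BB) B) ->
  s0 * q * q.+1 < degsum (A :\: cover BB).
Proof.
move=> q_gt2 hBB s0_gt0 gD nD; set D := A :\: cover BB in gD nD *.
have [_ strict] := degsum_heavy e_sym e_irr q_gt2 x0 gD; apply: strict => // y ly.
rewrite ltnNge; apply/negP => cy.
have sDA : D \subset A := subsetDl _ _.
have nbD v : v \in D -> nbh D v = nbh A v := nbh_components e_sym hBB.
have lowD v : v \in D -> (v \in low D) = (v \in low A).
  by move=> vD; have vA := subsetP sDA v vD; rewrite [LHS]in_set [RHS]in_set nbD // vD vA.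
have yD : y \in D := low_sub ly.
have cN := cnbh_clique e_sym q_gt2 gD ly; have kN := card_cnbh e_irr ly.
have sN : cnbh D y \subset D := cnbh_sub e yD.
have EN : cnbh D y = cnbh A y by rewrite /cnbh nbD.
have : ~~ [forall u in cnbh D y, nbh D u == cnbh D y :\ u].
  by have := nD (cnbh D y); rewrite /component sN kN eqxx.
rewrite negb_forall_in => /exists_inP[z zN nz].
have sz : cnbh D y :\ z \subset nbh D z by apply: clique_sub_nbh.
have [w wz nwN] : exists2 w, w \in nbh D z & w \notin cnbh D y.
  apply/subsetPn; apply: contra nz => sub; rewrite eqEsubset sz andbT.
  apply/subsetP => u uz; rewrite in_setD1 (subsetP sub) // andbT.
  by move: uz; rewrite in_nbh eq_sym => /andP[_ /(neq_of_adj e_irr)].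
have zD : z \in D := subsetP sN z zN.
have [wD ezw] : w \in D /\ e z w by move: wz; rewrite in_nbh => /andP[].
have kNz : #|cnbh D y :\ z| = q by have := cardsD1 z (cnbh D y); rewrite zN kN => -[].
have nlz : z \notin low D.
  rewrite inE zD /=; have : #|w |: (cnbh D y :\ z)| <= #|nbh D z|.
    by rewrite subset_leq_card // subUset sub1set wz.
  rewrite cardsU1 in_setD1 (negbTE nwN) andbF kNz add1n => lt.
  by apply/negP => /eqP Eq; rewrite Eq ltnn in lt.
have lN : low D :&: cnbh D y = cnbh D y :\ z.
  apply/eqP; rewrite eqEcard kNz cy andbT; apply/subsetP => u /setIP[lu uN].
  by rewrite in_setD1 uN andbT; apply: contraNneq nlz => <-.
have : ~~ e z w; last by rewrite ezw.
apply: (pendant_clique_saturated (y := y)); rewrite -?EN -?lowD //.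
- apply/subsetP => u uN; rewrite -lowD; first by move: uN; rewrite -lN => /setIP[].
  by apply: (subsetP sN); case/setD1P: uN.
- exact: (subsetP sDA).
Qed.

(** Here [p = q = 2], so [U] is empty. By transitivity a vertex of degree 2 would lie in a component
    [K_3]; so positive degrees are at least 3, the [2 * s0] covered vertices give the bound, and an
    uncovered one makes it strict. *)
Lemma degsum_no_component_matching (x0 : T) (BB : {set {set T}}) s0 : q = 2 ->
    {in BB, forall B, component e q A B} -> 0 < s0 ->
    robust e q (A :\: cover BB) s0 ->
    (forall B, ~~ component e q (A :\: cover BB) B) ->
  s0 * q * q.+1 < degsum (A :\: cover BB).
Proof.
move=> q2 hBB s0_gt0 gD nD; set D := A :\: cover BB in gD nD *.
have gT : robust e q setT s.
  suff <- : A = setT by [].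
  have /eqP : #|U| = 0 by rewrite kU; clear -p_le_q p_gt1 q2; lia.
  by rewrite cards_eq0 => /eqP->; rewrite setC0.
have tr u v w := @matching_adj_trans u v w q2 gT.
have d3 v : v \in D -> 0 < #|nbh D v| -> 2 < #|nbh D v|.
  move=> vD dv; have := deg_ge gD vD dv; rewrite q2 leq_eqVlt => /orP[/eqP d2|//].
  have /negP[] := nD (v |: nbh D v); apply/componentP; split.
  - by rewrite subUset sub1set vD; apply/subsetP => u; rewrite in_nbh => /andP[].
  - by rewrite cardsU1 in_nbh e_irr andbF -d2 q2.
  - move=> u /setU1P uv; apply/setP => t; rewrite in_nbh in_setD1 in_setU1 in_nbh.
    have evu : u = v \/ e v u by case: uv => [|]; [left | rewrite in_nbh => /andP[]; right].
    have uD : u \in D by case: uv => [->//|]; rewrite in_nbh => /andP[].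
    have [->|ntu] := eqVneq t u; first by rewrite e_irr andbF.
    have [tv|ntv] := eqVneq t v.
      rewrite tv vD /=; case: evu => [uv'|evu]; last by rewrite e_sym evu.
      by rewrite tv uv' eqxx in ntu.
    case: (boolP (t \in D)) => //= tD; case: evu => [->//|evu].
    apply/idP/idP => [eut|evt].
      by apply: (tr v u t); rewrite // eq_sym.
    by apply: (tr u v t); rewrite // 1?eq_sym // e_sym.
have dpos P v : packing e q D s0 P -> v \in cover P -> 0 < #|nbh D v|.
  move=> pP /coverP[Q QP vQ].
  apply: leq_trans (subset_leq_card (clique_sub_nbh (pk_sub pP QP) (pk_clique pP QP) vQ)).
  by have := cardsD1 v Q; rewrite vQ (pk_size pP QP) q2 add1n => -[<-].
have [v0 v0D d0] : exists2 v0, v0 \in D & 0 < #|nbh D v0|.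
  have [P pP _] := gD.2 x0.
  have /card_gt0P[Q QP] : 0 < #|P| by rewrite (pk_card pP).
  have /card_gt0P[v0 v0Q] : 0 < #|Q| by rewrite (pk_size pP QP).
  have v0P : v0 \in cover P by apply/coverP; exists Q.
  by exists v0; [apply: (subsetP (pk_sub pP QP)) | apply: dpos pP v0P].
have [P pP nv0] := gD.2 v0; have sP := cover_sub pP.
have v0DP : v0 \in D :\: cover P by apply/setDP.
rewrite /degsum (sum_setD _ sP) (bigD1 v0 v0DP) /=.
have : \sum_(v in cover P) 3 <= \sum_(v in cover P) #|nbh D v|.
  by apply: leq_sum => v vP; apply: d3; [apply: (subsetP sP) | apply: dpos pP vP].
rewrite sum_nat_const (card_cover pP) q2 => le; rewrite addnC.
by apply: leq_ltn_trans le _; rewrite -addn1 leq_add2l; apply: leq_trans d0 (leq_addr _ _).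
Qed.

End Structure.

(** A bound on twice the number of edges, with [(p - 2)(p - 1)] moved to the left to avoid
    subtraction. It is strict for large minimum degree and whenever fewer than [s] components
    [K_(q+1)] can be stripped. *)
Lemma saturated_degsum : 0 < s -> q * q.+1 * s + 3 * p.-2 < #|T| ->
  2 * p.-2 * #|T| + s * (q * q.+1) <= degsum setT + p.-2 * p.-1 /\
  (degsum setT + p.-2 * p.-1 = 2 * p.-2 * #|T| + s * (q * q.+1) ->
   exists U (BB : {set {set T}}), [/\ #|U| = p.-2, universal U, #|BB| = s,
     {in BB, forall B, component e q (~: U) B} &
     {in ~: U :\: cover BB &, forall u v, ~~ e u v}]).
Proof.
move=> s_gt0 hn.
have /card_gt0P[x0 _] : 0 < #|T| by apply: leq_ltn_trans hn.
have [x _ xmin] := @arg_minnP _ x0 xpredT (fun v => deg v) isT.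
have {}xmin v : deg x <= deg v by apply: xmin.
have [dx|dx] := leqP (deg x) p.-2; last first.
  have := degsum_high_min_degree xmin dx s_gt0 hn => lt.
  by split; [apply: ltnW | move=> Eq; rewrite Eq ltnn in lt].
have hT : p.-1 < #|T| by apply: leq_ltn_trans hn; clear -p_gt1 p_le_q s_gt0; nia.
have [U [kU uU gA]] := universal_min_degree dx hT.
have -> : p.-2 * p.-1 = p.-2 * p.-2.+1 by congr (_ * _); clear -p_gt1; lia.
have := degsum_universal e_sym e_irr uU; rewrite kU => ->.
have [BB [kBB hBB gD nD ->]] := strip_components e_sym e_irr q_gt1 gA.
have [s0|s0] := posnP (s - #|BB|).
  have kBs : #|BB| = s by clear -kBB s0; lia.
  rewrite s0 in gD; rewrite (degsum0 (robust0_indep gD)) kBs addn0; split=> // _.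
  by exists U, BB; split=> //; apply: (robust0_indep gD).
suff lt : (s - #|BB|) * q * q.+1 < degsum (~: U :\: cover BB).
  have E : s * (q * q.+1) = #|BB| * (q * q.+1) + (s - #|BB|) * q * q.+1.
    by rewrite -mulnA -mulnDl subnKC.
  by rewrite E; clear -lt; split; lia.
have [q3|q2] := ltnP 2 q.
  exact: degsum_no_component_heavy.
apply: degsum_no_component_matching => //; clear -q2 q_gt1; lia.
Qed.
End Saturated.

(** * From copies and edges of a graph to families of cliques and degree sums *)

Definition forbidden p q s := disjoint_union (complete p) (copies s (complete q)).

Lemma contains_forbiddenP (G : sgraph) p q s : 0 < p -> 0 < q ->
  contains_copy G (forbidden p q s) <-> exists F, copy_family p q s (@adj G) F.
Proof.
move=> p_gt0 q_gt0; split=> [[f f_inj f_hom]|[F [[kF dF [C CF [kC hq]]] cF]]].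
- pose Q (i : 'I_s) := [set f (inr (i, j)) | j : 'I_q].
  have QP i x : reflect (exists j, x = f (inr (i, j))) (x \in Q i).
    by apply: (iffP imsetP) => [[j _ ->]|[j ->]]; exists j.
  have Q_disj i i' x : x \in Q i -> x \in Q i' -> i = i'.
    by move=> /QP[j ->] /QP[j' /f_inj[]].
  pose P := [set Q i | i : 'I_s].
  have pP : packing (@adj G) q setT s P.
    split.
    + rewrite card_imset ?cardsT ?card_ord // => i i' eQ.
      have x0 : f (inr (i, Ordinal q_gt0)) \in Q i by apply/QP; exists (Ordinal q_gt0).
      by apply: (Q_disj _ _ _ x0); rewrite -eQ.
    + move=> _ /imsetP[i _ ->]; rewrite card_imset ?cardsT ?card_ord // => j j'.
      by move=> /f_inj[].
    + by move=> Q' _; apply: subsetT.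
    + move=> _ /imsetP[i _ ->] _ _ /QP[j ->] /QP[j' ->] njj'; apply: f_hom.
      by rewrite /= /copies_rel /= eqxx /complete_rel; apply: contraNneq njj' => ->.
    + move=> _ _ x /imsetP[i _ ->] /imsetP[i' _ ->] xi xi'.
      by rewrite (Q_disj i i' x).
  exists ([set f (inl i) | i : 'I_p] |: P); apply: (copy_family_add p_gt0 pP).
  + move=> _ _ /imsetP[i _ ->] /imsetP[i' _ ->] nii'; apply: f_hom.
    by rewrite /= /complete_rel; apply: contraNneq nii' => ->.
  + by rewrite card_imset ?cardsT ?card_ord // => j j' /f_inj[].
  + move=> _ /imsetP[i _ ->]; apply/negP => /coverP[_ /imsetP[k _ ->] /QP[j]].
    by move/f_inj.
- have /card_gt0P[x0 _] : 0 < #|C| by rewrite kC.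
  pose P := F :\ C.
  have kP : #|P| = s by have := cardsD1 C F; rewrite CF kF => -[].
  pose Q (i : 'I_s) := nth set0 (enum P) i.
  have ltP (i : 'I_s) : i < size (enum P) by rewrite -cardE kP.
  have QP i : Q i \in P by rewrite -mem_enum mem_nth.
  have QF i : Q i \in F by case/setD1P: (QP i).
  have kQ i : #|Q i| = q by case/setD1P: (QP i) => nQ QF'; apply: hq.
  pose g (x : 'I_p + 'I_s * 'I_q) := match x with
    | inl a => nth x0 (enum C) a
    | inr (i, b) => nth x0 (enum (Q i)) b end.
  have gC a : g (inl a) \in C by rewrite -mem_enum mem_nth // -cardE kC.
  have gQ i b : g (inr (i, b)) \in Q i by rewrite -mem_enum mem_nth // -cardE kQ.
  have nCQ i : Q i != C by case/setD1P: (QP i).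
  have g_inj : injective g.
    move=> [a|[i b]] [a'|[i' b']] Eg.
    + congr inl; apply/val_inj/eqP; move/eqP: Eg.
      by rewrite /g nth_uniq ?enum_uniq // -cardE kC.
    + have := gC a; rewrite Eg => h; case/eqP: (nCQ i').
      exact: dF (QF i') CF (gQ i' b') h.
    + have := gC a'; rewrite -Eg => h; case/eqP: (nCQ i).
      exact: dF (QF i) CF (gQ i b) h.
    + have Ei : i = i'.
        have := gQ i b; rewrite Eg => h.
        have EQ := dF _ _ _ (QF i') (QF i) (gQ i' b') h.
        apply/val_inj/eqP; rewrite -(nth_uniq set0 (ltP i) (ltP i') (enum_uniq _)).
        by rewrite -/(Q i) -/(Q i') EQ.
      subst i'; congr (inr (_, _)); apply/val_inj/eqP; move/eqP: Eg.
      by rewrite /g nth_uniq ?enum_uniq // -cardE kQ.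
  exists g => // -[a|[i b]] [a'|[i' b']] //= naa'.
  + apply: (cF C CF); rewrite ?gC // -/(g (inl a)) -/(g (inl a')).
    by rewrite (inj_eq g_inj); apply: contraNneq naa' => -[->].
  + have /andP[/eqP /= Ei nbb'] := naa'; rewrite -Ei.
    apply: (cF _ (QF i)); rewrite ?gQ // -/(g (inr (i, b))) -/(g (inr (i, b'))).
    by rewrite (inj_eq g_inj); apply: contraNneq nbb' => -[->].
Qed.

Lemma saturated_near_copy (G : sgraph) p q s : 0 < p -> 0 < q ->
    saturated (forbidden p q s) G ->
  (forall F, ~ copy_family p q s (@adj G) F) /\
  (forall x y : G, x != y -> ~~ adj x y ->
    exists F, exists C, near_copy (@adj G) p q s x y F C).
Proof.
move=> p_gt0 q_gt0 [noc sat].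
have noF F : ~ copy_family p q s (@adj G) F.
  by move=> cF; apply: noc; apply/contains_forbiddenP => //; exists F.
split=> // x y nxy nexy.
have [F [sF cF]] : exists F : {set {set G}}, copy_family p q s (add_edge_rel x y) F.
  by have /contains_forbiddenP[//|//|F cF] := sat x y nxy nexy; exists F.
have cl (X X' : {set G}) : X \in F -> X' \subset X -> ~~ ((x \in X') && (y \in X')) ->
    clique (@adj G) X'.
  move=> XF sX nX u v uX vX nuv.
  have := cF X XF u v (subsetP sX u uX) (subsetP sX v vX) nuv.
  case/orP=> // /andP[_ /orP[]] /andP[/eqP ux /eqP vy]; case/negP: nX.
    by rewrite -ux -vy uX.
  by rewrite -ux -vy vX.
have [/exists_inP[C CF /andP[xC yC]]|no] :=
  boolP [exists C in F, (x \in C) && (y \in C)]; last first.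
  case: (noF F); split=> // X XF; apply: (cl X) => //.
  by move: no; rewrite negb_exists_in => /forall_inP/(_ X XF).
exists F, C; split=> //.
- move=> X XF nXC; apply: (cl X) => //; apply: contra nXC => /andP[xX _].
  by apply/eqP; apply: (cs_disj sF XF CF xX xC).
- by apply: (cl C); rewrite ?subsetDl // in_setD1 eqxx.
- by apply: (cl C); rewrite ?subsetDl // [y \in _]in_setD1 eqxx andbF.
Qed.

(** Handshake lemma: sending an ordered adjacent pair to its set of ends is two-to-one onto the
    edges. *)
Lemma degsum_edges (G : sgraph) : degsum (@adj G) setT = 2 * #|edges G|.
Proof.
rewrite /degsum; under eq_bigr => v _ do rewrite card_nbh.
rewrite pair_big /= -big_mkcondr /=.
rewrite (partition_big (fun pr : G * G => [set pr.1; pr.2]) (mem (edges G))); last first.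
  move=> [u v] /= /andP[_ euv]; rewrite inE; apply/existsP; exists u.
  by apply/existsP; exists v; rewrite euv eqxx.
rewrite (eq_bigr (fun=> 2)) => [|E]; first by rewrite sum_nat_const mulnC.
rewrite !inE => /existsP[x /existsP[y /andP[exy /eqP ->]]].
have nxy : x != y := neq_of_adj (@adj_irrefl G) exy.
rewrite sum1_card (_ : #|_| = #|[set (x, y); (y, x)]|); last first.
  apply: eq_card => -[u v]; rewrite !inE /= unfold_in /= !xpair_eqE.
  apply/idP/idP => [/andP[/andP[_ euv] /eqP Euv]|].
    have /set2P uE : u \in [set x; y] by rewrite -Euv set21.
    have /set2P vE : v \in [set x; y] by rewrite -Euv set22.
    have := neq_of_adj (@adj_irrefl G) euv.
    by case: uE => ->; case: vE => ->; rewrite ?eqxx ?orbT.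
  case/orP=> /andP[/eqP-> /eqP->]; first by rewrite !inE exy eqxx.
  by rewrite !inE adj_sym exy setUC eqxx.
by rewrite cards2 xpair_eqE negb_and nxy.
Qed.

(** Elements of corresponding fibres are matched by their positions in the enumerations. The empty
    case is separate because [nth] needs a default. *)
Lemma fiber_bijection (I T1 T2 : finType) (lab1 : T1 -> I) (lab2 : T2 -> I) :
    (forall i, #|[set x | lab1 x == i]| = #|[set y | lab2 y == i]|) ->
    #|T1| = #|T2| ->
  exists2 f : T1 -> T2, bijective f & forall x, lab2 (f x) = lab1 x.
Proof.
move=> kf kT; have [T0|/card_gt0P[y0 _]] := posnP #|T2|.
  have no (x : T1) : False by have := card0_eq (etrans kT T0) x.
  have noy (y : T2) : False by have := card0_eq T0 y.
  exists (fun x => match no x with end) => [|x]; last by case: (no x).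
  by exists (fun y => match noy y with end) => [x|y]; [case: (no x)|case: (noy y)].
pose f1 i := [set x | lab1 x == i]; pose f2 i := [set y | lab2 y == i].
pose f x := nth y0 (enum (f2 (lab1 x))) (index x (enum (f1 (lab1 x)))).
have ltx x : index x (enum (f1 (lab1 x))) < #|f2 (lab1 x)|.
  by rewrite -kf cardE index_mem mem_enum inE.
have lab_f x : lab2 (f x) = lab1 x.
  have : f x \in f2 (lab1 x) by rewrite -mem_enum mem_nth // -cardE.
  by rewrite inE => /eqP.
exists f => //; apply: inj_card_bij; last by rewrite kT.
move=> x x' Ef; have El : lab1 x = lab1 x' by rewrite -!lab_f Ef.
have ltx' := ltx x'; rewrite -El in ltx'.
move/eqP: Ef; rewrite /f -El nth_uniq ?enum_uniq -?cardE //.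
by move/eqP=> Ei; apply: (index_inj x _ _ Ei); rewrite mem_enum inE ?El.
Qed.

(** * The extremal graph *)

Section Labelled.

Variables (p q s : nat).

(* None marks the vertices of the clique that is joined to everything, Some (Some i)
   those of the i-th K_(q+1), and Some None the isolated ones. *)
Definition labelled (G : sgraph) (lab : G -> option (option 'I_s)) :=
  [/\ forall x y, adj x y = (x != y) &&
         [|| lab x == None, lab y == None | (lab x == lab y) && (lab x != Some None)],
      #|[set x | lab x == None]| = p.-2 &
      forall i, #|[set x | lab x == Some (Some i)]| = q.+1].

Lemma labelled_iso (G H : sgraph) (lG : G -> option (option 'I_s))
    (lH : H -> option (option 'I_s)) :
  labelled lG -> labelled lH -> #|G| = #|H| -> isomorphic G H.
Proof.
move=> [aG uG bG] [aH uH bH] kGH.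
(* The number of vertices labelled [Some None] is not prescribed by [labelled]; it follows from the
   total. *)
have sumf (K : finType) (l : K -> option (option 'I_s)) :
    #|K| = #|[set x | l x == Some None]| +
      \sum_(i | i != Some None) #|[set x | l x == i]|.
  rewrite -[LHS]sum1_card [LHS](partition_big l xpredT) //= [LHS](bigD1 (Some None)) //=.
  congr (_ + _); first by rewrite -sum1_card; apply: eq_bigl => x; rewrite inE.
  by apply: eq_bigr => i _; rewrite -sum1_card; apply: eq_bigl => x; rewrite inE.
have kf i : i != Some None -> #|[set x | lG x == i]| = #|[set x | lH x == i]|.
  by case: i => [[i|]|] // _; rewrite ?bG ?bH ?uG ?uH.
have [|f f_bij lf] := fiber_bijection (lab1 := lG) (lab2 := lH) _ kGH.
  move=> i; have [->|/kf//] := eqVneq i (Some None).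
  move: kGH; rewrite (sumf G lG) (sumf H lH).
  by rewrite (eq_bigr _ kf) => /addIn.
exists f => // x y; rewrite aG aH !lf; congr (_ && _); congr negb.
exact/inj_eq/bij_inj.
Qed.

Lemma labelled_pullback (G H : sgraph) (f : G -> H) (lab : H -> option (option 'I_s)) :
  bijective f -> {mono f : x y / adj x y} -> labelled lab -> labelled (lab \o f).
Proof.
move=> f_bij f_mono [aH uH bH].
have kf l : #|[set x | lab (f x) == l]| = #|[set y | lab y == l]|.
  rewrite -(on_card_preimset (f := f)) => [|]; last exact: onW_bij.
  by apply: eq_card => x; rewrite !inE.
split=> [x y||i] /=; rewrite ?kf //.
by rewrite -f_mono aH (inj_eq (bij_inj f_bij)).
Qed.

Section LabelledGraph.

Variables (G : sgraph) (lab : G -> option (option 'I_s)).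
Hypotheses (p_gt1 : 1 < p) (p_le_q : p <= q) (labG : labelled lab).

Let U := [set x | lab x == None].
Let block i := [set x | lab x == Some (Some i)].

Let adj_lab x y : adj x y = (x != y) &&
  [|| lab x == None, lab y == None | (lab x == lab y) && (lab x != Some None)].
Proof. by case: labG. Qed.

Let card_U : #|U| = p.-2. Proof. by case: labG. Qed.
Let card_block i : #|block i| = q.+1. Proof. by case: labG => _ _; apply. Qed.

Lemma labelled_universal : universal (@adj G) U.
Proof. by move=> u v; rewrite inE adj_lab (eq_sym u) => -> ->. Qed.

(** Equality in [saturated_degsum]: outside [U] only the vertices of the [s] blocks have neighbours,
    [q] each. *)
Lemma labelled_degsum :
  degsum (@adj G) setT + p.-2 * p.-1 = 2 * p.-2 * #|G| + s * (q * q.+1).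
Proof.
have := degsum_universal (@adj_sym G) (@adj_irrefl G) labelled_universal.
rewrite card_U.
have -> : p.-2.+1 = p.-1 by clear -p_gt1; lia.
move=> ->; congr (_ + _).
have -> : s * (q * q.+1) = \sum_(i < s) \sum_(v in block i) q.
  rewrite (eq_bigr (fun=> q * q.+1)) => [|i _]; first by rewrite sum_nat_const card_ord.
  by rewrite sum_nat_const card_block mulnC.
pose isb v := if lab v is Some (Some i) then true else false.
rewrite (exchange_big_dep isb) /=; last by move=> i v _; rewrite inE /isb => /eqP->.
rewrite /degsum (bigID isb) /= addnC big1 ?add0n; last first.
  move=> v; rewrite !inE /isb => /andP[nU nb]; apply/eqP; rewrite cards_eq0.
  apply/eqP/setP => u; rewrite !inE adj_lab.
  case Ev: (lab v) nU nb => [[i|]|] // _ _; rewrite andbF orbF /=.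
  by case: (lab u == None); rewrite ?andbF.
apply: eq_big => [v|v].
  by rewrite !inE /isb; case: (lab v) => [[i|]|].
move=> /andP[_]; rewrite /isb; case Ev: (lab v) => [[i|]|] // _.
have -> : nbh (@adj G) (~: U) v = block i :\ v.
  apply/setP => u; rewrite !inE adj_lab Ev /= andbT (eq_sym v u) (eq_sym (Some _)).
  by case: (lab u) => [l|] //=; rewrite andbF.
have := cardsD1 v (block i); rewrite inE Ev eqxx card_block add1n => -[<-].
rewrite (big_pred1 i) // => j; rewrite inE Ev /=.
by apply/eqP/eqP => [[->]|->].
Qed.

(** A clique meeting no block has at most [p - 1] vertices, [p - 2] in [U] and one isolated, so each
    member meets a block. Two members meeting the same block would fit into its union with [U], of
    size [p + q - 1]. So the [s + 1] members would inject into the [s] blocks. *)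
Lemma labelled_no_copy F : ~ copy_family p q s (@adj G) F.
Proof.
case=> sF cF.
pose meets (X : {set G}) i := [exists x in X, lab x == Some (Some i)].
have meet X : X \in F -> exists i, meets X i.
  move=> XF; apply/existsP; rewrite -[X in is_true X]negbK negb_exists.
  apply/negP => /forallP no.
  have iso x : x \in X :\: U -> lab x = Some None.
    case/setDP=> xX; rewrite inE; case Ex: (lab x) => [[i|]|] // _.
    by case/negP: (no i); apply/exists_inP; exists x; rewrite // Ex.
  have le1 : #|X :\: U| <= 1.
    rewrite leqNgt; apply/negP => /card_gt1P[x [y [xX yX nxy]]].
    have : adj x y by apply: (cF X XF) => //; [case/setDP: xX | case/setDP: yX].
    by rewrite adj_lab !iso //= ?eqxx andbF.
  have := copy_shape_ge p_le_q sF XF; rewrite -(cardsID U X).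
  have := subset_leq_card (subsetIr X U); rewrite card_U.
  by clear -p_gt1 le1; lia.
have inUB X i x : X \in F -> meets X i -> x \in X -> x \in U :|: block i.
  move=> XF /exists_inP[y yX /eqP Ey] xX; rewrite !inE.
  have [->|nxy] := eqVneq x y; first by rewrite Ey eqxx orbT.
  have : adj x y by apply: (cF X XF).
  rewrite adj_lab Ey => /andP[_ /or3P[->//|//|/andP[-> _]]].
  by rewrite orbT.
pose g X := [pick i | meets X i].
have gP X : X \in F -> exists2 i, g X = Some i & meets X i.
  move=> /meet[i0 mi0]; rewrite /g; case: pickP => [i mi|no]; first by exists i.
  by rewrite no in mi0.
have g_inj : {in F &, injective g}.
  move=> X Y XF YF gXY; apply/eqP/negPn/negP => nXY.
  have [i gX mX] := gP X XF; have [j gY mY] := gP Y YF.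
  have Eij : j = i by move: gXY; rewrite gX gY => -[].
  have sXY : X :|: Y \subset U :|: block i.
    apply/subsetP => x /setUP[xX|xY]; first exact: (inUB X).
    by rewrite -Eij; apply: (inUB Y).
  have XY0 : X :&: Y = set0.
    apply/setP => x; rewrite inE [RHS]inE; apply/negbTE/andP => -[xX xY].
    by case/eqP: nXY; apply: (cs_disj sF XF YF xX xY).
  have := subset_leq_card sXY; have := cardsUI X Y; rewrite XY0 cards0.
  have := copy_shape_ge2 p_le_q sF XF YF nXY.
  have := (leq_card_setU U (block i)).1; rewrite card_U card_block.
  by clear -p_gt1; lia.
have : #|g @: F| <= #|[set Some i | i : 'I_s]|.
  apply/subset_leq_card/subsetP => _ /imsetP[X XF ->].
  by have [i -> _] := gP X XF; apply: imset_f.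
rewrite card_in_imset // (cs_card sF) card_imset ?cardsT ?card_ord ?ltnn //.
by move=> i j [].
Qed.

(** Nonadjacent [x] and [y] lie outside [U] and in no common block. Adding [xy] turns [U] with [x]
    and [y] into a [K_p], and each block, losing at most one vertex, still contains a [K_q]. *)
Lemma labelled_saturated : saturated (forbidden p q s) G.
Proof.
have p_gt0 : 0 < p := ltnW p_gt1; have q_gt0 : 0 < q := leq_trans p_gt0 p_le_q.
split=> [|x y nxy nexy].
  by move/(contains_forbiddenP _ _ p_gt0 q_gt0)=> [F]; apply: labelled_no_copy.
apply/contains_forbiddenP => //.
have [nUx nUy] : x \notin U /\ y \notin U.
  by move: nexy; rewrite adj_lab nxy !inE !negb_or => /and3P[].
have nxyb i : x \in block i -> y \notin block i.
  rewrite !inE => /eqP Ex; apply: contra nexy => /eqP Ey.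
  by rewrite adj_lab nxy Ex Ey eqxx.
pose avoiding i (Q : {set G}) :=
  [/\ Q \subset block i, #|Q| = q, x \notin Q & y \notin Q].
have /fin_all_exists[Q hQ] : forall i, exists Q, avoiding i Q.
  move=> i.
  have rem r : r \in block i -> #|block i :\ r| = q.
    by move=> rB; have := cardsD1 r (block i); rewrite rB card_block => -[].
  have [xB|nxB] := boolP (x \in block i).
    exists (block i :\ x); rewrite /avoiding subsetDl rem // !in_setD1 eqxx; split=> //.
    by rewrite negb_and (nxyb i xB) orbT.
  have [yB|nyB] := boolP (y \in block i).
    exists (block i :\ y); rewrite /avoiding subsetDl rem // !in_setD1 eqxx; split=> //.
    by rewrite negb_and nxB orbT.
  have /card_gt0P[r rB] : 0 < #|block i| by rewrite card_block.
  exists (block i :\ r); rewrite /avoiding subsetDl rem // !in_setD1.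
  by rewrite (negbTE nxB) (negbTE nyB) !andbF.
have Q_disj i j z : z \in Q i -> z \in Q j -> i = j.
  have [/subsetP si _ _ _] := hQ i; have [/subsetP sj _ _ _] := hQ j.
  by move=> /si + /sj; rewrite !inE => /eqP-> /eqP[].
have Q0 i : exists z, z \in Q i by apply/card_gt0P; have [_ -> _ _] := hQ i.
pose P := [set Q i | i : 'I_s].
have pP : packing (@adj (add_edge x y)) q setT s P.
  split.
  - rewrite card_imset ?cardsT ?card_ord // => i j EQ.
    by have [z zi] := Q0 i; apply: (Q_disj i j z) => //; rewrite -EQ.
  - by move=> _ /imsetP[i _ ->]; have [] := hQ i.
  - by move=> Q' _; apply: subsetT.
  - move=> _ /imsetP[i _ ->] u v ui vi nuv; apply/orP; left.
    have [/subsetP si _ _ _] := hQ i; move: (si u ui) (si v vi).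
    by rewrite !inE adj_lab nuv => /eqP-> /eqP->; rewrite eqxx orbT.
  - move=> _ _ z /imsetP[i _ ->] /imsetP[j _ ->] zi zj.
    by rewrite (Q_disj i j z).
exists ((x |: (y |: U)) |: P); apply: (copy_family_add p_gt0 pP).
- have uU := labelled_universal.
  have au u v : u \in U -> v != u -> adj v u by move=> uU' nvu; rewrite adj_sym uU.
  apply: (cliqueU1 (@add_edge_sym G x y)).
    apply: (cliqueU1 (@add_edge_sym G x y)).
      by move=> u v uU' _ nuv; apply/orP; left; apply: uU; rewrite // eq_sym.
    by move=> z zU nzy; apply/orP; left; apply: au; rewrite // eq_sym.
  move=> z /setU1P[->|zU] nzx; first by rewrite /= /add_edge_rel nxy !eqxx orbT.
  by apply/orP; left; apply: au; rewrite // eq_sym.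
- rewrite (cardsU1 x) (cardsU1 y) in_setU1 negb_or nxy nUx nUy card_U /=.
  by clear -p_gt1; lia.
- move=> z zC; apply/negP => /coverP[_ /imsetP[i _ ->] zi].
  have [/subsetP si _ nxi nyi] := hQ i.
  case/setU1P: zC => [zx|/setU1P[zy|]].
  + by rewrite zx (negbTE nxi) in zi.
  + by rewrite zy (negbTE nyi) in zi.
  + by have := si z zi; rewrite !inE => /eqP->.
Qed.

End LabelledGraph.

Lemma components_labelled (G : sgraph) (U : {set G}) (BB : {set {set G}}) :
    1 < q -> #|U| = p.-2 -> universal (@adj G) U -> #|BB| = s ->
    {in BB, forall B, component (@adj G) q (~: U) B} ->
    {in ~: U :\: cover BB &, forall u v, ~~ adj u v} ->
  exists lab : G -> option (option 'I_s), labelled lab.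
Proof.
move=> q_gt1 kU uU kBB hBB indep.
pose B (i : 'I_s) := nth set0 (enum BB) i.
have ltB (i : 'I_s) : i < size (enum BB) by rewrite -cardE kBB.
have BBB i : B i \in BB by rewrite -mem_enum mem_nth.
have dBB := components_disjoint hBB.
have B_disj i j x : x \in B i -> x \in B j -> i = j.
  move=> xi xj; apply/val_inj/eqP.
  rewrite -(nth_uniq set0 (ltB i) (ltB j) (enum_uniq _)).
  by rewrite -/(B i) -/(B j) (dBB _ _ x (BBB i) (BBB j)).
pose lab x := if x \in U then None else Some [pick i | x \in B i].
have sBU i x : x \in B i -> x \notin U.
  by have /componentP[/subsetP sB _ _] := hBB _ (BBB i); move/sB; rewrite inE.
have labU x : (lab x == None) = (x \in U) by rewrite /lab; case: ifP.
have labB x i : (lab x == Some (Some i)) = (x \in B i).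
  rewrite /lab; case: ifPn => [xU|nxU].
    by apply/esym/negbTE/negP => /sBU; rewrite xU.
  case: pickP => [j xj|no]; last by rewrite no.
  apply/eqP/idP => [[<-]//|xi]; by rewrite (B_disj _ _ _ xi xj).
have labI x : lab x = Some None -> x \in ~: U :\: cover BB.
  move=> lx; rewrite in_setD in_setC -labU lx andbT.
  apply/negP => /coverP[B' B'B xB'].
  have ltx : index B' (enum BB) < s by rewrite -kBB cardE index_mem mem_enum.
  have : lab x == Some (Some (Ordinal ltx)) by rewrite labB /B nth_index // mem_enum.
  by rewrite lx.
exists lab; split=> [x y||i]; last 2 first.
- by rewrite -kU; apply: eq_card => x; rewrite inE labU.
- have /componentP[_ <- _] := hBB _ (BBB i).
  by apply: eq_card => x; rewrite inE labB.
have [->|nxy] := eqVneq x y; first by rewrite adj_irrefl.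
have [xU|nxU] := boolP (x \in U); first by rewrite labU xU uU // eq_sym.
have [yU|nyU] := boolP (y \in U); first by rewrite !labU yU orbT adj_sym uU.
rewrite !labU (negbTE nxU) (negbTE nyU) /=.
have [xA yA] : x \in ~: U /\ y \in ~: U by rewrite !inE.
case Ex: (lab x) => [[i|]|]; last by move: nxU; rewrite -labU Ex.
- have xi : x \in B i by rewrite -labB Ex.
  rewrite andbT eq_sym labB; apply/idP/idP => [exy|yi].
    exact: (component_closed (hBB _ (BBB i)) xi yA exy).
  exact: (component_clique (hBB _ (BBB i))).
- rewrite andbF; apply/negbTE/negP => exy.
  case Ey: (lab y) => [[j|]|]; last by move: nyU; rewrite -labU Ey.
    have yj : y \in B j by rewrite -labB Ey.
    have xj : x \in B j.
      by apply: (component_closed (hBB _ (BBB j)) yj xA); rewrite adj_sym.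
    by move: xj; rewrite -labB Ex.
  by have := indep x y (labI x Ex) (labI y Ey); rewrite exy.
Qed.

End Labelled.

(** * The join as a labelled graph, and the characterization of the minimum *)

Definition extremal p q s m :=
  join (complete (p - 2)) (disjoint_union (copies s (complete (q + 1))) (edgeless m)).

Lemma extremal_labelled p q s m :
  exists lab : extremal p q s m -> option (option 'I_s), labelled p q lab.
Proof.
pose lab (x : extremal p q s m) : option (option 'I_s) := match x with
  | inl _ => None
  | inr (inl (i, _)) => Some (Some i)
  | inr (inr _) => Some None end.
exists lab; split.
- move=> [a|[[i b]|c]] [a'|[[i' b']|c']] //=; rewrite ?andbT ?andbF //.
  rewrite /sum_rel /= /copies_rel /=.
  have -> : (inr (inl (i, b)) != inr (inl (i', b')) :> extremal p q s m) =
            ~~ ((i == i') && (b == b')) by [].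
  have -> : (Some (Some i) == Some (Some i') :> option (option 'I_s)) = (i == i') by [].
  by rewrite /complete_rel; case: (i == i') => //=; rewrite andbT.
- have -> : [set x | lab x == None] = [set inl a | a : 'I_(p - 2)].
    apply/setP => x; rewrite inE; apply/idP/imsetP => [|[a _ ->]//].
    by case: x => [a|[[i b]|c]] // _; exists a.
  by rewrite card_imset ?cardsT ?card_ord ?subn2 // => a a' [].
- move=> i; have -> : [set x | lab x == Some (Some i)] =
      [set inr (inl (i, b)) | b : 'I_(q + 1)].
    apply/setP => x; rewrite inE; apply/idP/imsetP => [|[b _ ->]]; last exact/eqP.
    by case: x => [a|[[j b]|c]] //= /eqP[<-]; exists b.
  by rewrite card_imset ?cardsT ?card_ord ?addn1 // => a a' [].
Qed.

Lemma card_extremal p q s m : #|extremal p q s m| = p - 2 + (s * (q + 1) + m).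
Proof. by rewrite !card_sum card_prod !card_ord. Qed.

Theorem theorem1 (p q t n : nat) (hp : 2 <= p) (hpq : p <= q) (ht : 2 <= t)
    (hn : q * (q + 1) * (t - 1) + 3 * (p - 2) < n) :
  forall G : sgraph,
    Sat n (disjoint_union (complete p) (copies (t - 1) (complete q))) G <->
    isomorphic G
      (join (complete (p - 2))
            (disjoint_union (copies (t - 1) (complete (q + 1)))
                            (edgeless (n - t + 3 - p - q * (t - 1))))).
Proof.
move=> G; set s := t - 1; set m := n - t + 3 - p - q * s.
rewrite -/(forbidden p q s) -/(extremal p q s m).
have s_gt0 : 0 < s by rewrite /s; lia.
(* The bound [hn] makes the truncated subtractions in [m] exact. *)
have kK : #|extremal p q s m| = n.
  by rewrite card_extremal /m /s in hn s_gt0 *; nia.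
have [labK LK] := extremal_labelled p q s m.
have satK := labelled_saturated hp hpq LK.
have eK := labelled_degsum hp LK; rewrite degsum_edges kK in eK.
(* The extremal graph attains the lower bound on the degree sum, and any saturated graph attaining
   it carries a labelling. *)
have bound (H : sgraph) : #|H| = n -> saturated (forbidden p q s) H ->
    #|edges (extremal p q s m)| <= #|edges H| /\
    (#|edges H| = #|edges (extremal p q s m)| ->
     exists lab : H -> option (option 'I_s), labelled p q lab).
  move=> kH satH.
  have p_gt0 : 0 < p := ltnW hp; have q_gt0 : 0 < q := leq_trans p_gt0 hpq.
  have [noc near] := saturated_near_copy p_gt0 q_gt0 satH.
  have hH : q * q.+1 * s + 3 * p.-2 < #|H| by move: hn; rewrite kH addn1 subn2.
  have [le eq] := saturated_degsum (@adj_sym H) (@adj_irrefl H) hp hpq noc near s_gt0 hH.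
  rewrite degsum_edges kH -eK in le eq; split; first by clear -le; lia.
  move=> E; rewrite E in eq; have [U [BB [kU uU kBB hBB ind]]] := eq erefl.
  by apply: (components_labelled _ kU uU kBB hBB ind); apply: leq_trans hp hpq.
split=> [[kG satG [_ minG]]|[f f_bij f_mono]].
  have [le eq] := bound G kG satG.
  have [|lG LG] := eq.
    by apply/eqP; rewrite eqn_leq le andbT; apply: minG.
  by apply: (labelled_iso LG LK); rewrite kG kK.
have LG := labelled_pullback f_bij f_mono LK.
have kG : #|G| = n by rewrite (bij_eq_card f_bij).
have satG := labelled_saturated hp hpq LG.
have eG := labelled_degsum hp LG; rewrite degsum_edges kG in eG.
have E : #|edges G| = #|edges (extremal p q s m)| by clear -eG eK; lia.
split=> //; split; first by exists G.
by move=> H kH satH; rewrite E; have [] := bound H kH satH.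
Qed.
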